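(* Let $n\in\mathbb N$ and let $Y=\{0\}^2$ or $Y=\{0\}\times\mathbb C$. Then the operator $A_Y$ associated in $H_Y$ with the form $a(u,v)=\int_0^1u\overline v\,dx$ on $V^{(n)}_{Y,2}$ has domain $D(A_Y)=\{u\in H^1(0,1):\mu_0(u)=\mu_n(u)=0\}$ if $Y=\{0\}^2$, and $D(A_Y)=\{u\in H^1(0,1):\mu_0(u)=0,\ u(0)=u(1)\}$ if $Y=\{0\}\times\mathbb C$; in both cases $A_Yu=\mathrm{Id}_m^{-1}\big(-u''+\gamma(u)(1-x)^{n-2}\big)$.
   Context: Functions are complex-valued. $H^1(T):=\{u\in H^1(0,1):u(0)=u(1)\}$, $H^{-1}(T)$ its (anti)dual with pivot $L^2(0,1)$; $\mathcal D(T)$: $C^\infty$ functions on $[0,1]$ with all derivatives coinciding at $0$ and $1$. For $k\in\mathbb N_0$, $\mu_k(f):=\int_0^1(1-x)^kf\,dx$ ($f\in L^1$), $\mu_0(f):=\langle f,1\rangle$ ($f\in H^{-1}(T)$). $\gamma:H^1(0,1)\to\mathbb C$ is $\gamma(f):=(n-1)(2n-1)f(0)-(n-1)^2(2n-1)\mu_{n-2}(f)$ if $n\ge2$ and $\gamma:=0$ if $n=1$ (the term $\gamma(u)(1-x)^{n-2}$ is then absent). For $f\in H^{-1}(0,1)$, $\mathrm{Id}_m^{-1}f$ is the unique $w\in H^{-1}(T)$ with $\mu_0(w)=0$ whose restriction to $H^1_0(0,1)$ is $f$. $V^{(n)}_{Y,2}:=\{u\in L^2(0,1):(\mu_0(u),\mu_n(u))\in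 Y\}$; $H_Y:=\{f\in H^{-1}(T):\mu_0(f)=0\}$ here, with inner product $(f|g)_{H_Y}:=\int_0^1P_nf\,\overline{P_ng}\,dx+\mu_0(f)\overline{\mu_0(g)}$, where $P_nf$ is the distribution $\varphi\mapsto\langle f,J_n\varphi\rangle$, $J_n\varphi(x):=\int_x^1\varphi\,dy-\mu_0(\varphi)(1-x)^n$. The associated operator: $D(A_Y):=\{f\in V^{(n)}_{Y,2}:\exists g\in H_Y,\ a(f,h)=(g|h)_{H_Y}\ \forall h\in V^{(n)}_{Y,2}\}$, $A_Yf:=g$. *)

(* Defs.v *)
From mathcomp Require Import all_boot all_order all_algebra.
From mathcomp Require Import all_classical all_reals all_analysis.
From mathcomp.real_closed Require Import complex.
Import Order.TTheory GRing.Theory Num.Theory.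
Set Implicit Arguments.
Unset Strict Implicit.
Unset Printing Implicit Defensive.
Local Open Scope ring_scope.
Local Open Scope classical_set_scope.

Section Defs.
Variable R : realType.
Local Notation C := R[i].
Local Notation mu := (@lebesgue_measure R).

Definition I01 : set R := `[0%R, 1%R].

Definition cR (r : R) : C := Complex r 0.

Definition cint (A : set R) (f : R -> C) : C :=
  cR (Rintegral mu A (fun x => complex.Re (f x)))
  + Complex 0 1 * cR (Rintegral mu A (fun x => complex.Im (f x))).

Definition cint01 (f : R -> C) : C := cint I01 f.

Definition cabs2 (z : C) : R := complex.Re z ^+ 2 + complex.Im z ^+ 2.

Definition L2 (f : R -> C) : Prop :=
  measurable_fun I01 (fun x => complex.Re (f x)) /\
  measurable_fun I01 (fun x => complex.Im (f x)) /\
  (\int[mu]_(x in I01) (cabs2 (f x))%:E < +oo)%E.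

Definition L2norm2 (f : R -> C) : R := Rintegral mu I01 (fun x => cabs2 (f x)).

Definition ae_eq01 (f g : R -> C) : Prop :=
  {ae mu, forall x, x \in I01 -> f x = g x}.

(* H^1(0,1): [H1rep u v c] says that on [0,1], u is the continuous function
   u(x) = c + int_0^x v with v in L^2(0,1); v is the weak derivative u'. *)
Definition H1rep (u v : R -> C) (c : C) : Prop :=
  L2 v /\ forall x, x \in I01 -> u x = c + cint (`[0%R, x] : set R) v.

Definition H1 (u : R -> C) : Prop := exists v c, H1rep u v c.

Definition H1T (u : R -> C) : Prop := H1 u /\ u 0 = u 1.

Definition H10 (u : R -> C) : Prop := H1 u /\ u 0 = 0 /\ u 1 = 0.

(* D(T): C^oo functions on [0,1] whose derivatives of all orders coincide at 0
   and 1, i.e. (restrictions of) 1-periodic C^oo functions on R. *)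
Definition DT (phi : R -> C) : Prop :=
  (forall x, phi (x + 1) = phi x) /\
  (forall (k : nat) (x : R),
      derivable (derive1n k (fun y => complex.Re (phi y))) x 1 /\
      derivable (derive1n k (fun y => complex.Im (phi y))) x 1).

Definition Hm1T (F : (R -> C) -> C) : Prop :=
  (forall (a b : C) (u w : R -> C), H1T u -> H1T w ->
     F (fun x => a * u x + b * w x) = conjc a * F u + conjc b * F w) /\
  (exists M : R, forall u v c, H1rep u v c -> u 0 = u 1 ->
     cabs2 (F u) <= M * (L2norm2 u + L2norm2 v)).

(* L^2(0,1) embedded in H^{-1}(T) via the pivot L^2 pairing *)
Definition emb (f : R -> C) : (R -> C) -> C :=
  fun phi => cint01 (fun x => f x * conjc (phi x)).

Definition mu0 (F : (R -> C) -> C) : C := F (fun _ => 1).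

Definition muk (k : nat) (f : R -> C) : C :=
  cint01 (fun x => cR ((1 - x) ^+ k) * f x).

Definition Jn (n : nat) (phi : R -> C) : R -> C :=
  fun x => cint (`[x, 1%R] : set R) phi - cint01 phi * cR ((1 - x) ^+ n).

(* [IsPn n F p]: the distribution P_n F (phi |-> <F, J_n phi>) is the
   L^2(0,1) function p *)
Definition IsPn (n : nat) (F : (R -> C) -> C) (p : R -> C) : Prop :=
  L2 p /\ forall phi, DT phi -> F (Jn n phi) = cint01 (fun x => p x * conjc (phi x)).

Definition HY (F : (R -> C) -> C) : Prop := Hm1T F /\ mu0 F = 0.

Inductive Ychoice := Y00 (* {0}^2 *) | Y0C (* {0} x C *).

Definition Yset (Y : Ychoice) : set (C * C) :=
  match Y with
  | Y00 => [set z | z.1 = 0 /\ z.2 = 0]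
  | Y0C => [set z | z.1 = 0]
  end.

Definition VY (n : nat) (Y : Ychoice) (u : R -> C) : Prop :=
  L2 u /\ Yset Y (mu0 (emb u), muk n u).

Definition aform (u v : R -> C) : C := cint01 (fun x => u x * conjc (v x)).

(* [IsAY n Y f g]: g = A_Y f, i.e. f in V, g in H_Y and
   a(f,h) = (g|h)_{H_Y} for all h in V, where
   (g|h)_{H_Y} = int_0^1 P_n g conj(P_n h) + mu_0(g) conj(mu_0(h)). *)
Definition IsAY (n : nat) (Y : Ychoice) (f : R -> C) (g : (R -> C) -> C) : Prop :=
  VY n Y f /\ HY g /\
  forall h, VY n Y h ->
    exists pg ph, IsPn n g pg /\ IsPn n (emb h) ph /\
      aform f h = cint01 (fun x => pg x * conjc (ph x))
                  + mu0 g * conjc (mu0 (emb h)).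

Definition DomAY (n : nat) (Y : Ychoice) (f : R -> C) : Prop := exists g, IsAY n Y f g.

(* gamma(u), u(0) being the value of the continuous representative *)
Definition gamma (n : nat) (u : R -> C) : C :=
  if (2 <= n)%N then
    cR ((n.-1)%:R * (2 * n - 1)%N%:R) * u 0
    - cR ((n.-1)%:R ^+ 2 * (2 * n - 1)%N%:R) * muk (n - 2)%N u
  else 0.

(* [IsIdmInv w l]: w = Id_m^{-1} l for the element l of H^{-1}(0,1) given
   by its action l phi psi on phi in H^1_0(0,1) with derivative psi:
   w in H^{-1}(T), mu_0(w) = 0 and w restricted to H^1_0(0,1) equals l. *)
Definition IsIdmInv (w : (R -> C) -> C) (l : (R -> C) -> (R -> C) -> C) : Prop :=
  Hm1T w /\ mu0 w = 0 /\
  forall phi psi c, H1rep phi psi c -> phi 0 = 0 -> phi 1 = 0 -> w phi = l phi psi.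

(* the element -u'' + gamma(u)(1-x)^{n-2} of H^{-1}(0,1), u in H^1 with u' = v:
   phi |-> int u' conj(phi') + gamma(u) int (1-x)^{n-2} conj(phi) *)
Definition rhs (n : nat) (u v : R -> C) : (R -> C) -> (R -> C) -> C :=
  fun phi psi =>
    cint01 (fun x => v x * conjc (psi x))
    + gamma n u * cint01 (fun x => cR ((1 - x) ^+ (n - 2)%N) * conjc (phi x)).

Definition DomCond (n : nat) (Y : Ychoice) (u : R -> C) : Prop :=
  match Y with
  | Y00 => mu0 (emb u) = 0 /\ muk n u = 0
  | Y0C => mu0 (emb u) = 0 /\ u 0 = u 1
  end.

End Defs.

(* Main.v *)
Require Import Defs.
From mathcomp Require Import all_boot all_order all_algebra.
From mathcomp Require Import all_classical all_reals all_analysis.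
From mathcomp.real_closed Require Import complex.
From mathcomp Require Import measurable_realfun simple_functions.
From mathcomp Require Import measurable_fun_approximation ring lra.
Import Order.TTheory GRing.Theory Num.Theory.
Import numFieldNormedType.Exports.
Set Implicit Arguments.
Unset Strict Implicit.
Unset Printing Implicit Defensive.
Local Open Scope ring_scope.
Local Open Scope classical_set_scope.

(** Write P_n h = h_1 - mu_n(h), with h_1 the primitive of h vanishing at 0.
    If A_Y f = g and p = P_n g, testing the form against h in V gives, after one
    integration by parts, that f + p_1 + p_1(1) (1-x)^n is orthogonal to V; hence
    f = a + b (1-x)^n - p_1 almost everywhere, which puts f in H^1 and yields the
    boundary or moment condition.  Since J_n annihilates (1-x)^(n-1), p is
    orthogonal to (1-x)^(n-1), and this fixes b in terms of u(0) and
    mu_(n-2)(u): (n-1) n b = gamma(u).  Conversely, p is read off from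
    p + u' in span (1-x)^(n-1) and orthogonality, and g is phi |-> - (p | phi').
    Test functions in D(T) only determine L^2 objects through density, which is
    reduced to indicators of [0, x] by a monotone class argument. *)

(** * Real square integrable functions on [0, 1] *)

Section RealL2.
Variable R : realType.
Local Notation mu := (@lebesgue_measure R).
Local Notation I := (@I01 R).
Implicit Types f g h : R -> R.

(** The two choices of Y differ through the orthogonal complement of V. For {0}^2 it is spanned by 1
    and (1-x)^n: b stays free, and the condition mu_n(u) = 0 is inherited from V. For {0} x C it
    consists of constants: this forces b = - p_1(1), which is u(0) = u(1), since u(0) = a + b and
    u(1) = a - p_1(1).

    The constants in gamma arise as follows. Pairing u' = - n b (1-x)^(n-1) - p with (1-x)^(n-1), of
    squared norm 1/(2n-1), removes p; integrating u' by parts gives n b = (2n-1) (u(0) - (n-1)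
    mu_(n-2)(u)). One more integration by parts, against a test function in H^1_0, supplies the
    other factor n-1 and the exponent n-2.

    Functions here are not classes modulo null sets, and elements of H^{-1}(T) act on functions on
    the whole line. Invariance under a.e. equality, or under changes outside [0, 1], is therefore
    derived from continuity bounds, and a weak derivative is compared with another only through its
    pairings. *)

Definition L2r f :=
  measurable_fun I f /\ (\int[mu]_(x in I) (f x ^+ 2)%:E < +oo)%E.

Definition ipr f g : R := \int[mu]_(x in I) (f x * g x).

Lemma ae_imp (P Q : R -> Prop) : (forall x, P x -> Q x) ->
  {ae mu, forall x, P x} -> {ae mu, forall x, Q x}.
Proof. by move=> PQ; apply: (@filterS _ (almost_everywhere mu)). Qed.

Lemma ae_imp2 (P Q S : R -> Prop) : (forall x, P x -> Q x -> S x) ->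
  {ae mu, forall x, P x} -> {ae mu, forall x, Q x} -> {ae mu, forall x, S x}.
Proof. by move=> PQ; apply: (@filterS2 _ (almost_everywhere mu)). Qed.

Lemma measurable_I01 : @measurable _ (measurableTypeR R) I.
Proof. exact: measurable_itv. Qed.

Lemma mu_I01 : mu I = 1%E.
Proof. by rewrite /I01 lebesgue_measure_itv/= lte_fin ltr01 -EFinB subr0. Qed.

Lemma L2r_sq f : L2r f -> mu.-integrable I (EFin \o (fun x => f x ^+ 2)).
Proof.
move=> [mf f2]; apply/integrableP; split.
  by apply/measurable_EFinP; exact: measurable_funX.
under eq_integral do rewrite /= ger0_norm ?sqr_ge0//.
exact: f2.
Qed.

Lemma L2r_of_sq f : measurable_fun I f ->
  mu.-integrable I (EFin \o (fun x => f x ^+ 2)) -> L2r f.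
Proof. by move=> mf f2; split => //; apply: integrable_lty f2; exact: measurable_I01. Qed.

Lemma L2r_mul f g : L2r f -> L2r g ->
  mu.-integrable I (EFin \o (fun x => f x * g x)).
Proof.
move=> Lf Lg; have mI := measurable_I01.
apply: (@le_integrable _ _ _ mu I mI _
   (EFin \o (fun x => f x ^+ 2 + g x ^+ 2))).
- by apply/measurable_EFinP; apply: measurable_funM; [case: Lf|case: Lg].
- move=> x _ /=; rewrite lee_fin [leRHS]ger0_norm ?addr_ge0 ?sqr_ge0//.
  move: (f x) (g x) => a b; rewrite ler_norml.
  have := sqr_ge0 (a + b); have := sqr_ge0 (a - b).
  have := sqr_ge0 a; have := sqr_ge0 b.
  by rewrite !expr2 => *; apply/andP; split; lra.
- exact: (integrableD mI (L2r_sq Lf) (L2r_sq Lg)).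
Qed.

Lemma bounded_L2r f (M : R) : measurable_fun I f ->
  (forall x, I x -> `|f x| <= M) -> L2r f.
Proof.
move=> mf fM; apply: L2r_of_sq => //.
have mI := measurable_I01.
apply: (@le_integrable _ _ _ mu I mI _ (EFin \o cst (M ^+ 2))).
- by apply/measurable_EFinP; exact: measurable_funX.
- move=> x Ix /=; rewrite lee_fin !ger0_norm ?sqr_ge0// -[leLHS]real_normK ?num_real//.
  by rewrite ler_sqr ?nnegrE ?fM// (le_trans _ (fM _ Ix)).
- apply/integrableP; split; first exact/measurable_EFinP/measurable_cst.
  rewrite [X in (X < _)%E](integral_cst mu mI (`|M ^+ 2|%:E)).
  by rewrite [X in (_ * X)%E]mu_I01 mule1 ltry.
Qed.

Lemma L2r_cst (c : R) : L2r (fun=> c).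
Proof. by apply: (@bounded_L2r _ `|c|). Qed.

Lemma L2r_int f : L2r f -> mu.-integrable I (EFin \o f).
Proof.
move=> Lf; have := L2r_mul Lf (L2r_cst 1); apply: (eq_integrable measurable_I01).
by move=> x _ /=; rewrite mulr1.
Qed.

Lemma L2rD f g : L2r f -> L2r g -> L2r (fun x => f x + g x).
Proof.
move=> Lf Lg; have mI := measurable_I01; apply: L2r_of_sq.
  by apply: measurable_funD; [case: Lf|case: Lg].
have := integrableD mI (integrableD mI (L2r_sq Lf) (L2r_sq Lg))
   (integrableZl mI 2 (L2r_mul Lf Lg)).
apply: (eq_integrable mI) => x _ /=; congr (_%:E); ring.
Qed.

Lemma L2rZ (c : R) f : L2r f -> L2r (fun x => c * f x).
Proof.
move=> Lf; have mI := measurable_I01; apply: L2r_of_sq.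
  by apply: measurable_funM => //; case: Lf.
have := integrableZl mI (c ^+ 2) (L2r_sq Lf).
by apply: (eq_integrable mI) => x _ /=; rewrite exprMn.
Qed.

Lemma L2rN f : L2r f -> L2r (fun x => - f x).
Proof.
by move=> /(L2rZ (-1)); congr L2r; apply/funext => x; rewrite mulN1r.
Qed.

Lemma L2rB f g : L2r f -> L2r g -> L2r (fun x => f x - g x).
Proof. by move=> Lf /L2rN; exact: L2rD. Qed.

Lemma le_L2r f g : measurable_fun I f -> L2r g ->
  (forall x, I x -> `|f x| <= `|g x|) -> L2r f.
Proof.
move=> mf Lg fg; apply: L2r_of_sq => //.
apply: (le_integrable measurable_I01 _ _ (L2r_sq Lg)).
  by apply/measurable_EFinP; exact: measurable_funX.
move=> x Ix /=; rewrite lee_fin !ger0_norm ?sqr_ge0//.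
by rewrite -(real_normK (num_real (f x))) -(real_normK (num_real (g x))) ler_sqr ?nnegrE ?fg.
Qed.

Lemma eq_L2r f g : (forall x, I x -> f x = g x) -> L2r f -> L2r g.
Proof.
move=> fg Lf; apply: (le_L2r _ Lf) => [|x Ix]; last by rewrite fg.
by case: Lf => mf _; apply: eq_measurable_fun mf => x /set_mem; exact: fg.
Qed.

Lemma ipC f g : ipr f g = ipr g f.
Proof. by apply: eq_Rintegral => x _; rewrite mulrC. Qed.

Lemma ipDl f g h : L2r f -> L2r g -> L2r h ->
  ipr (fun x => f x + g x) h = ipr f h + ipr g h.
Proof.
move=> Lf Lg Lh; rewrite /ipr -RintegralD ?L2r_mul//; last exact: measurable_I01.
by apply: eq_Rintegral => x _; rewrite mulrDl.
Qed.

Lemma ipZl (c : R) f h : L2r f -> L2r h ->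
  ipr (fun x => c * f x) h = c * ipr f h.
Proof.
move=> Lf Lh; rewrite /ipr -RintegralZl ?L2r_mul//; last exact: measurable_I01.
by apply: eq_Rintegral => x _; rewrite mulrA.
Qed.

Lemma ipr0l h : L2r h -> ipr (fun=> 0) h = 0.
Proof.
move=> Lh; transitivity (0 * ipr (fun=> 0) h); last exact: mul0r.
rewrite -(ipZl 0 (L2r_cst 0) Lh).
by congr (ipr _ h); apply/funext => x; rewrite mulr0.
Qed.

Lemma ipr_ge0 f : 0 <= ipr f f.
Proof. by apply: Rintegral_ge0 => x _; rewrite -expr2 sqr_ge0. Qed.

Lemma ipr_comb (a b : R) f g : L2r f -> L2r g ->
  ipr (fun x => a * f x + b * g x) (fun x => a * f x + b * g x) =
  a ^+ 2 * ipr f f + 2 * a * b * ipr f g + b ^+ 2 * ipr g g.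
Proof.
move=> Lf Lg; have La := L2rZ a Lf; have Lb := L2rZ b Lg.
rewrite ipDl ?ipZl//; try exact: L2rD.
rewrite (ipC f) (ipC g) !ipDl ?ipZl// (ipC g f); ring.
Qed.

Lemma cauchy_schwarz f g : L2r f -> L2r g ->
  ipr f g ^+ 2 <= ipr f f * ipr g g.
Proof.
move=> Lf Lg.
have H a b := ipr_ge0 (fun x => a * f x + b * g x).
have {}H a b : 0 <= a ^+ 2 * ipr f f + 2 * a * b * ipr f g + b ^+ 2 * ipr g g.
  by rewrite -ipr_comb.
have := ipr_ge0 g; rewrite le_eqVlt => /predU1P[g0|gp]; last first.
  have := H (ipr g g) (- ipr f g); nra.
(* If [ipr g g = 0], these coefficients reduce the form to minus the square of [ipr f g], which is
   therefore zero. *)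
have := H (- ipr f g) ((ipr f f + 1) / 2); rewrite -g0 mulr0.
have := ipr_ge0 f; nra.
Qed.

Lemma ipr_le_sum f g : L2r f -> L2r g ->
  ipr (fun x => f x + g x) (fun x => f x + g x) <= 2 * ipr f f + 2 * ipr g g.
Proof.
move=> Lf Lg.
have := ipr_comb 1 1 Lf Lg; have := ipr_comb 1 (-1) Lf Lg.
have := ipr_ge0 (fun x => 1 * f x + -1 * g x).
have -> : (fun x => f x + g x) = (fun x => 1 * f x + 1 * g x).
  by apply/funext => x; rewrite !mul1r.
lra.
Qed.

Lemma ipr_eq_ae f g h : L2r f -> L2r g -> L2r h ->
  {ae mu, forall x, I x -> f x = g x} -> ipr f h = ipr g h.
Proof.
move=> Lf Lg Lh fg; rewrite /ipr /Rintegral; congr fine.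
apply: ae_eq_integral.
- exact: measurable_I01.
- by apply: (measurable_int mu); apply: L2r_mul.
- by apply: (measurable_int mu); apply: L2r_mul.
- by apply: ae_imp fg => x /= + Ix => ->.
Qed.

Lemma ipr0_ae f : L2r f -> ipr f f = 0 -> {ae mu, forall x, I x -> f x = 0}.
Proof.
move=> Lf; rewrite /ipr => f0.
have mm := measurable_int mu (L2r_mul Lf Lf).
have : (\int[mu]_(x in I) `|(EFin \o (fun x => f x * f x)%R) x| = 0)%E.
  transitivity (\int[mu]_(x in I) (f x * f x)%:E)%E.
    by apply: eq_integral => x _; rewrite /= ger0_norm// -expr2 sqr_ge0.
  rewrite -[LHS]fineK ?[fine _]f0//; apply: integrable_fin_num (L2r_mul Lf Lf).
  exact: measurable_I01.
move=> /ae_eq_integral_abs => /(_ measurable_I01).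
move=> /(_ mm); apply: ae_imp => x /= + Ix => /(_ Ix)[] /eqP.
by rewrite mulf_eq0 orbb => /eqP.
Qed.

Lemma L2r_dominated (F : nat -> R -> R) f G : (forall n, L2r (F n)) -> L2r f ->
  L2r G -> (forall n x, I x -> `|f x - F n x| <= G x) ->
  {ae mu, forall x, I x -> F ^~ x @ \oo --> f x} ->
  forall e : R, 0 < e ->
  exists n, ipr (fun x => f x - F n x) (fun x => f x - F n x) < e.
Proof.
move=> LF Lf LG FG Ff e e0.
have LD n := L2rB Lf (LF n).
have [] := @dominated_convergence _ _ _ mu I measurable_I01
  (fun n => EFin \o (fun x => (f x - F n x) * (f x - F n x))) (cst 0%E)
  (EFin \o (fun x => G x * G x)).
- by move=> n; exact: (measurable_int mu (L2r_mul (LD n) (LD n))).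
- exact: measurable_cst.
- apply: ae_imp Ff => x /= + Ix => /(_ Ix) Fx.
  apply: cvg_EFin; first exact: nearW.
  rewrite /comp/=.
  have -> : 0 = (f x - f x) * (f x - f x) by rewrite subrr mul0r.
  by apply: cvgM; apply: cvgB => //; exact: cvg_cst.
- exact: L2r_mul.
- apply: aeW => x n Ix /=; rewrite lee_fin normrM.
  have := FG n x Ix => ?; exact: ler_pM.
move=> _ _ /=; rewrite integral0 => /fine_cvgP[_].
move=> /cvgrPdist_lt/(_ e e0)[N _ /(_ N (leqnn N))] /=.
rewrite sub0r normrN => H; exists N; apply: le_lt_trans H.
exact: ler_norm.
Qed.

End RealL2.

(** * Closed subspaces containing the indicators of the intervals [0, x] *)

Section Density.
Variable R : realType.
Local Notation mu := (@lebesgue_measure R).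
Local Notation I := (@I01 R).
Implicit Types f g h : R -> R.

(** [N] is a bare predicate on functions. Closedness asks for one approximant per [e], and it
    already implies invariance under a.e. equality: a function is at distance zero from any other in
    its class. *)
Definition L2r_closed_subspace (N : (R -> R) -> Prop) :=
  (forall a b f g, L2r f -> L2r g -> N f -> N g ->
     N (fun x => a * f x + b * g x)) /\
  (forall f, L2r f ->
     (forall e : R, 0 < e -> exists g, [/\ L2r g, N g &
        ipr (fun x => f x - g x) (fun x => f x - g x) < e]) -> N f).

Lemma closed_ae_ext N f g : L2r_closed_subspace N -> L2r f -> L2r g ->
  {ae mu, forall x, I x -> f x = g x} -> N f -> N g.
Proof.
move=> [_ cl] Lf Lg fg Nf; apply: cl => // e e0; exists f; split=> //.
rewrite (@ipr_eq_ae R _ (fun=> 0)); first 1 last.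
- exact: L2rB.
- exact: L2r_cst.
- exact: L2rB.
- by apply: ae_imp fg => x /= + Ix => ->//; rewrite subrr.
by rewrite ipr0l//; exact: L2rB.
Qed.

Lemma closed_ext N f g : L2r_closed_subspace N -> L2r f ->
  (forall x, I x -> f x = g x) -> N f -> N g.
Proof.
move=> cN Lf fg; apply: closed_ae_ext => //; first exact: eq_L2r Lf.
exact: aeW.
Qed.

Lemma closed_dominated N (F : nat -> R -> R) f G : L2r_closed_subspace N ->
  (forall n, L2r (F n)) -> L2r f -> L2r G ->
  (forall n x, I x -> `|f x - F n x| <= G x) ->
  {ae mu, forall x, I x -> F ^~ x @ \oo --> f x} ->
  (forall n, N (F n)) -> N f.
Proof.
move=> [_ cl] LF Lf LG FG Ff NF; apply: cl => // e e0.
by have [n Hn] := L2r_dominated LF Lf LG FG Ff e0; exists (F n).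
Qed.

Lemma indic_L2r (A : set R) : measurable A -> L2r (\1_A : R -> R).
Proof.
move=> mA; apply: (@bounded_L2r _ _ 1).
  by apply: measurable_funTS; exact: measurable_indic.
by move=> x _; rewrite indicE; case: (_ \in _); rewrite ?normr1 ?normr0.
Qed.

Lemma measurable_itv0 (x : R) : measurable (`[0, x] : set R).
Proof. exact: measurable_itv. Qed.

Lemma ae_neq (a : R) : {ae mu, forall x, x != a}.
Proof.
exists [set a]; split; first exact: measurable_set1.
  exact: lebesgue_measure_set1.
by move=> x /= /negP; rewrite negbK => /eqP.
Qed.

(** * From intervals to Borel sets, simple functions and all of L^2 *)

Section Indicators.
Import HBNNSimple.
Variable N : (R -> R) -> Prop.
Hypothesis cN : L2r_closed_subspace N.
Hypothesis N_itv : forall x : R, 0 <= x -> x <= 1 -> N (\1_(`[0, x] : set R)).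

Lemma closed_cst0 : N (fun=> 0).
Proof.
have L1 := indic_L2r (measurable_itv0 1).
have N1 := N_itv ler01 (lexx 1).
have := cN.1 0 0 _ _ L1 L1 N1 N1; apply: closed_ext => //.
  by apply: L2rD; apply: L2rZ.
by move=> x _; rewrite !mul0r addr0.
Qed.

Lemma closed_indicT : N (\1_setT).
Proof.
apply: closed_ext (N_itv ler01 (lexx 1)) => //; first exact: indic_L2r.
by move=> x Ix; rewrite !indicE in_setT mem_set.
Qed.

(** Open rays generate the Borel sets and are stable under intersection. On [0, 1] such a ray is
    empty, everything, or [0, x] up to the null set {x}. *)
Lemma closed_indic_ray (x : R) : N (\1_(`]-oo, x[ : set R)).
Proof.
have [x0|x0] := leP x 0.
  apply: closed_ext closed_cst0 => //; first exact: L2r_cst.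
  move=> y; rewrite /I01/= in_itv/= => /andP[y0 _].
  by rewrite indicE memNset//= in_itv/=; apply/negP; rewrite -leNgt (le_trans x0).
have [x1|x1] := leP x 1; last first.
  apply: closed_ext closed_indicT => //; first exact: indic_L2r.
  move=> y; rewrite /I01/= in_itv/= => /andP[_ y1].
  by rewrite !indicE in_setT mem_set//= in_itv/= (le_lt_trans y1).
apply: closed_ae_ext (N_itv (ltW x0) x1) => //; try exact: indic_L2r.
apply: ae_imp (ae_neq x) => y /= yx.
rewrite /I01/= in_itv/= => /andP[y0 _]; rewrite !indicE.
congr (nat_of_bool _)%:R; apply/idP/idP; rewrite !inE/= !in_itv/= y0/=.
  by rewrite lt_neqAle yx.
exact: ltW.
Qed.

(** Dynkin's theorem: complements are differences with the full indicator. A disjoint union is the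
    bounded limit of its partial unions, whose indicators are finite sums by disjointness. *)
Lemma closed_indic (A : set R) : measurable A -> N (\1_A).
Proof.
rewrite -[measurable]/(@measurable _ (measurableTypeR R)).
have -> : @measurable _ (measurableTypeR R) = <<s @RGenInftyO.G R >>.
  exact: RGenInftyO.measurableE.
move: A; apply: (@dynkin_induction _ (measurableTypeR R) (@RGenInftyO.G R)
  (fun A => N (\1_A))).
- exact: RGenInftyO.measurableE.
- move=> _ _ [x ->] [y ->]; exists (Num.min x y).
  by apply/seteqP; split=> z /=; rewrite !in_itv/= lt_min => /andP.
- exact: closed_indicT.
- by move=> _ [x ->]; exact: closed_indic_ray.
- move=> S mS NS.
  have := cN.1 1 (-1) _ _ (indic_L2r measurableT) (indic_L2r mS) closed_indicT NS.
  apply: closed_ext => //.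
    by apply: L2rD; apply: L2rZ; apply: indic_L2r => //.
  move=> x _; rewrite !indicE in_setT in_setC; case: (x \in S) => /=; lra.
- move=> F mF tF NF.
  pose U n := \big[setU/set0]_(k < n) F k.
  have mU n : measurable (U n) by apply: bigsetU_measurable.
  apply: (@closed_dominated _ (fun n => \1_(U n)) _ (fun=> 1)) => //.
  + by move=> n; exact: indic_L2r (mU n).
  + apply: indic_L2r; exact: (@bigcupT_measurable _ (measurableTypeR R)).
  + exact: L2r_cst.
  + move=> n x _; rewrite !indicE.
    by case: (_ \in _); case: (_ \in _); rewrite ?subr0 ?subrr ?sub0r ?normrN ?normr1 ?normr0.
  + apply: aeW => x _.
    have [[k _ Fkx]|nF] := pselect ((\bigcup_k F k) x); last first.
      rewrite indicE memNset//; apply: cvg_near_cst; apply: nearW => n.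
      rewrite indicE memNset//; rewrite /U -bigcup_mkord => -[i _ Fi].
      by apply: nF; exists i.
    rewrite indicE mem_set; last by exists k.
    apply: cvg_near_cst; exists k.+1 => // n /= kn.
    rewrite indicE mem_set//; rewrite /U -bigcup_mkord; by exists k.
  + elim=> [|n IH].
      have := closed_cst0; apply: closed_ext => //; first exact: L2r_cst.
      by move=> x _; rewrite /U big_ord0 indic0.
    have := cN.1 1 1 _ _ (indic_L2r (mU n)) (indic_L2r (mF n)) IH (NF n).
    apply: closed_ext => //; first by apply: L2rD; apply: L2rZ; [exact: indic_L2r (mU n)|exact: indic_L2r (mF n)].
    move=> x _; rewrite /U big_ord_recr/= !mul1r !indicE in_setU.
    have [xn|xn] := boolP (x \in F n); rewrite ?orbT ?orbF ?addr0//.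
    rewrite memNset ?add0r// -bigcup_mkord => -[i /= ilt Fi].
    have /trivIsetP/(_ i n) := tF; move=> /(_ Logic.I Logic.I).
    rewrite neq_ltn ilt => /(_ isT) E; suff : (F i `&` F n) x by rewrite E.
    by split=> //; exact: set_mem.
Qed.

Lemma closed_sum (J : Type) (s : seq J) (F : J -> R -> R) :
  (forall j, L2r (F j)) -> (forall j, N (F j)) ->
  L2r (fun x => \sum_(j <- s) F j x) /\ N (fun x => \sum_(j <- s) F j x).
Proof.
move=> LF NF; elim: s => [|j s [Ls Ns]].
  under eq_fun do rewrite big_nil; split; [exact: L2r_cst|exact: closed_cst0].
under eq_fun do rewrite big_cons; split; first exact: L2rD.
have := cN.1 1 1 _ _ (LF j) Ls (NF j) Ns; apply: closed_ext => //.
  by apply: L2rD; apply: L2rZ.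
by move=> x _; rewrite !mul1r.
Qed.

Lemma closed_sfun (f : {nnsfun (measurableTypeR R) >-> R}) : L2r f /\ N f.
Proof.
have -> : (f : R -> R) = fun x => \sum_(y \in range f) (y * \1_(f @^-1` [set y]) x).
  by apply/funext => x; rewrite fimfunE.
under eq_fun do rewrite fsbig_finite//=.
have mf y : @measurable _ (measurableTypeR R) (f @^-1` [set y]).
  exact: measurable_sfunP.
have Lf y := indic_L2r (mf y).
apply: closed_sum => y; first exact: L2rZ.
have := cN.1 y 0 _ _ (Lf y) (Lf y) (closed_indic (mf y)) (closed_indic (mf y)).
apply: closed_ext => //; first by apply: L2rD; apply: L2rZ.
by move=> x _; rewrite mul0r addr0.
Qed.

(** The simple functions increasing to [f] satisfy 0 <= f - F_n <= f, so [f] itself is the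
    dominating function. *)
Lemma closed_nonneg f : L2r f -> (forall x, I x -> 0 <= f x) -> N f.
Proof.
move=> Lf f0.
have mf : @measurable_fun _ _ (measurableTypeR R) _ I (EFin \o f).
  by apply: (measurable_int mu); exact: L2r_int.
have ef0 x : I x -> (0 <= (EFin \o f) x)%E by move=> Ix; rewrite lee_fin f0.
pose F := nnsfun_approx (@measurable_I01 R) mf.
have Ff x : I x -> F ^~ x @ \oo --> f x.
  by move=> Ix; have := cvg_nnsfun_approx (@measurable_I01 R) mf ef0 Ix => /fine_cvgP[].
have Fle n x : I x -> F n x <= f x.
  move=> Ix; rewrite -(cvg_lim _ (Ff _ Ix))//.
  apply: nondecreasing_cvgn_le; last by apply/cvg_ex; eexists; exact: Ff.
  by move=> a b ab; have /lefP := nd_nnsfun_approx (@measurable_I01 R) mf ab; exact.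
apply: (@closed_dominated _ F _ f) => //.
- by move=> n; case: (closed_sfun (F n)).
- move=> n x Ix; rewrite ger0_norm ?subr_ge0 ?Fle// lerBlDr lerDl; exact: fun_ge0.
- exact: aeW.
- by move=> n; case: (closed_sfun (F n)).
Qed.

Lemma closed_subspace_full f : L2r f -> N f.
Proof.
move=> Lf; have [mf _] := Lf.
pose fp x := Num.max (f x) 0; pose fm x := Num.max (- f x) 0.
have Lp : L2r fp.
  apply: (le_L2r _ Lf); first by apply: measurable_maxr => //; exact: measurable_cst.
  by move=> x _; rewrite /fp; case: (leP (f x) 0) => _; rewrite ?normr0 ?normr_ge0.
have Lm : L2r fm.
  apply: (le_L2r _ (L2rN Lf)).
    by apply: measurable_maxr; [case: (L2rN Lf)|exact: measurable_cst].
  by move=> x _; rewrite /fm; case: (leP (- f x) 0) => _; rewrite ?normr0 ?normr_ge0.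
have Np : N fp by apply: closed_nonneg => // x _; rewrite le_max lexx orbT.
have Nm : N fm by apply: closed_nonneg => // x _; rewrite le_max lexx orbT.
have := cN.1 1 (-1) _ _ Lp Lm Np Nm; apply: closed_ext => //.
  by apply: L2rD; apply: L2rZ.
move=> x _; rewrite /fp /fm mul1r mulN1r; case: (leP (f x) 0); case: (leP (- f x) 0); lra.
Qed.

End Indicators.
End Density.

(** * Density of smooth periodic functions *)

Section Smooth.
Variable R : realType.
Local Notation mu := (@lebesgue_measure R).
Local Notation I := (@I01 R).

(* Each generator's derivative lies again in the class, so members are C^oo. *)
Inductive elementary : (R -> R) -> Prop :=
| elementary_cst c : elementary (fun=> c)
| elementary_sin a b : elementary (fun x => sin (a * x + b))
| elementary_cos a b : elementary (fun x => cos (a * x + b))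
| elementary_add f g : elementary f -> elementary g ->
    elementary (fun x => f x + g x)
| elementary_mul f g : elementary f -> elementary g ->
    elementary (fun x => f x * g x)
| elementary_exp f : elementary f -> elementary (fun x => expR (f x)).

Lemma is_derive_affine (a b x : R) : is_derive x 1 (fun y => a * y + b) a.
Proof.
have H := is_deriveD (is_deriveZ a (is_derive_id x (1 : R))) (is_derive_cst b x (1 : R)).
by apply: (is_derive_eq H); rewrite addr0 /GRing.scale/= mulr1.
Qed.

Lemma elementary_derivable f : elementary f ->
  exists2 g, elementary g & forall x, is_derive x (1 : R) f (g x).
Proof.
elim=> [c|a b|a b|{}f g _ [f' ef' df] _ [g' eg' dg]
       |{}f g ef [f' ef' df] eg [g' eg' dg]|{}f ef [f' ef' df]].
- by exists (fun=> 0); [exact: elementary_cst|move=> x; exact: is_derive_cst].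
- exists (fun x => cos (a * x + b) * a).
    by apply: elementary_mul; [exact: elementary_cos|exact: elementary_cst].
  move=> x; have := is_derive_affine a b x => da.
  exact: (@is_derive1_comp _ sin _ x _ _ (is_derive_sin _) da).
- exists (fun x => (-1) * sin (a * x + b) * a).
    apply: elementary_mul; last exact: elementary_cst.
    by apply: elementary_mul; [exact: elementary_cst|exact: elementary_sin].
  move=> x; have := is_derive_affine a b x => da.
  rewrite mulN1r.
  exact: (@is_derive1_comp _ cos _ x _ _ (is_derive_cos _) da).
- exists (fun x => f' x + g' x); first exact: elementary_add.
  by move=> x; exact: is_deriveD (df x) (dg x).
- exists (fun x => f x * g' x + g x * f' x).
    by apply: elementary_add; apply: elementary_mul.
  by move=> x; exact: is_deriveM (df x) (dg x).
- exists (fun x => expR (f x) * f' x).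
    by apply: elementary_mul => //; exact: elementary_exp.
  by move=> x; exact: (@is_derive1_comp _ expR _ x _ _ (is_derive_expR _) (df x)).
Qed.

Lemma elementary_derive1n k f : elementary f -> elementary (derive1n k f).
Proof.
move=> ef; elim: k => [//|k IH] /=.
have [g eg dg] := elementary_derivable IH.
suff -> : (derive1n k f)^`() = g by [].
by apply/funext => x; rewrite derive1E; exact: (@derive_val _ _ _ _ _ _ _ (dg x)).
Qed.

Lemma elementary_DT f : elementary f -> (forall x, f (x + 1) = f x) ->
  DT (fun x => cR (f x)).
Proof.
move=> ef pf; split=> [x|k x]; first by rewrite pf.
split.
  have [g _ dg] := elementary_derivable (elementary_derive1n k ef).
  exact: (@ex_derive _ _ _ _ _ _ _ (dg x)).
have [g _ dg] := elementary_derivable (elementary_derive1n k (elementary_cst 0)).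
exact: (@ex_derive _ _ _ _ _ _ _ (dg x)).
Qed.

Lemma elementary_measurable f : elementary f -> measurable_fun I f.
Proof.
move=> ef; apply: measurable_funTS; apply: continuous_measurable_fun => x.
have [g _ dg] := elementary_derivable ef.
apply: differentiable_continuous; apply/derivable1_diffP.
exact: (@ex_derive _ _ _ _ _ _ _ (dg x)).
Qed.

(* The sign of [step_phase x y] for [0 < y < 1] is that of [x - y]; composing
   with the steep profile [t |-> exp (- exp (- k t))] gives periodic smooth
   functions tending boundedly to the indicator of [0, x]. *)
Definition step_phase (x y : R) : R := sin (pi * y) * sin (pi * (x - y)).

Definition smooth_step (x : R) (k : nat) (y : R) : R :=
  expR (- expR (- (k%:R * step_phase x y))).

Lemma elementary_smooth_step x k : elementary (smooth_step x k).
Proof.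
have -> : smooth_step x k = fun y => expR ((-1) *
   expR (- k%:R * (sin (pi * y + 0) * sin (- pi * y + pi * x)))).
  apply/funext => y; rewrite /smooth_step /step_phase mulN1r mulNr addr0.
  by have -> : - pi * y + pi * x = pi * (x - y) by ring.
apply: elementary_exp; apply: elementary_mul; first exact: elementary_cst.
apply: elementary_exp; apply: elementary_mul; first exact: elementary_cst.
by apply: elementary_mul; exact: elementary_sin.
Qed.

(** Each sine in the phase changes sign under a shift by 1, so their product has period 1 although
    the factors do not. *)
Lemma smooth_step_DT x k : DT (fun y => cR (smooth_step x k y)).
Proof.
apply: elementary_DT; first exact: elementary_smooth_step.
move=> y; rewrite /smooth_step /step_phase.
have -> : pi * (x - (y + 1)) = pi * (x - y) - pi by ring.
have -> : sin (pi * (x - y) - pi) = - sin (pi * (x - y)).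
  by rewrite -[in RHS](subrK pi (pi * (x - y))) sinDpi opprK.
by rewrite mulrDr mulr1 sinDpi mulrNN.
Qed.

Lemma sin_pi_gt0 (t : R) : 0 < t -> t < 1 -> 0 < sin (pi * t).
Proof.
move=> t0 t1; have p0 := pi_gt0 R; apply: sin_gt0_pi.
by rewrite mulr_gt0//= -[ltRHS]mulr1 ltr_pM2l.
Qed.

Lemma step_phase_gt0 (x y : R) : 0 < y -> y < x -> x <= 1 ->
  0 < step_phase x y.
Proof. by move=> *; apply: mulr_gt0; apply: sin_pi_gt0; lra. Qed.

Lemma step_phase_lt0 (x y : R) : 0 <= x -> x < y -> y < 1 ->
  step_phase x y < 0.
Proof.
move=> x0 xy y1.
have -> : step_phase x y = - (sin (pi * y) * sin (pi * (y - x))).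
  by rewrite /step_phase -(opprB y x) mulrN sinN mulrN.
by rewrite oppr_lt0; apply: mulr_gt0; apply: sin_pi_gt0; lra.
Qed.

Lemma smooth_step_ge0 x k y : 0 <= smooth_step x k y.
Proof. exact: expR_ge0. Qed.

Lemma smooth_step_le1 x k y : smooth_step x k y <= 1.
Proof. by rewrite /smooth_step -expR0 ler_expR oppr_le0 expR_ge0. Qed.

Lemma expR_geometric (t : R) : t < 0 -> (fun k : nat => expR (k%:R * t)) @ \oo --> (0 : R).
Proof.
move=> t0; under eq_fun do rewrite expRM_natl.
by apply: cvg_expr; rewrite ger0_norm ?expR_ge0// -expR0 ltr_expR.
Qed.

Lemma smooth_step_cvg x y : 0 <= x -> x <= 1 -> 0 < y -> y < 1 -> y != x ->
  smooth_step x ^~ y @ \oo --> (\1_(`[0, x] : set R) y : R).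
Proof.
move=> x0 x1 y0 y1; rewrite neq_lt => /orP[yx|xy].
  rewrite indicE mem_set/=; last by rewrite in_itv/= (ltW y0) (ltW yx).
  have q0 := step_phase_gt0 y0 yx x1.
  have -> : 1 = expR (- 0) :> R by rewrite oppr0 expR0.
  apply: (@cvg_comp _ _ _ (fun k => - expR (- (k%:R * step_phase x y))) expR _ (nbhs (- 0 : R))); last exact: continuous_expR.
  apply: cvgN; under eq_fun do rewrite -mulrN.
  by apply: expR_geometric; rewrite oppr_lt0.
rewrite indicE memNset/=; last by rewrite in_itv/= => /andP[_]; rewrite leNgt xy.
have q0 := step_phase_lt0 x0 xy y1.
(* With t = k times the phase, exp(-t) >= 1 - t gives exp(-exp(-t)) <= exp(t), a geometric sequence
   tending to 0 because the phase is negative. *)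
apply: (@squeeze_cvgr _ _ _ _ (fun=> 0) (fun k => expR (k%:R * step_phase x y))).
- apply: nearW => k; rewrite smooth_step_ge0/= /smooth_step ler_expR.
  set t := _ * _; have := expR_ge1Dx (- t); lra.
- exact: cvg_cst.
- exact: expR_geometric.
Qed.

Lemma closed_subspace_DT_full (N : (R -> R) -> Prop) f :
  L2r_closed_subspace N ->
  (forall e, L2r e -> DT (fun x => cR (e x)) -> N e) -> L2r f -> N f.
Proof.
move=> cN NDT; apply: closed_subspace_full => // x x0 x1.
have Ls k : L2r (smooth_step x k).
  apply: (@bounded_L2r _ _ 1); first exact: elementary_measurable (elementary_smooth_step x k).
  by move=> y _; rewrite ger0_norm ?smooth_step_ge0 ?smooth_step_le1.
apply: (closed_dominated (F := smooth_step x) cN _ _ (L2r_cst 1)) => //.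
- exact: indic_L2r.
- move=> k y _; have := smooth_step_ge0 x k y; have := smooth_step_le1 x k y.
  rewrite ler_norml indicE; case: (_ \in _) => /= *; lra.
(* At 0, 1 and [x] the phase vanishes and every step equals exp(-1); convergence is claimed only off
   these points. *)
- have ae01 : {ae mu, forall y : R, y != 0 /\ y != 1}.
    exact: ae_imp2 (fun y a b => conj a b) (ae_neq 0) (ae_neq 1).
  apply: ae_imp2 (ae_neq x) ae01 => y yx [y0 y1].
  rewrite /I01/= in_itv/= => /andP[y0' y1']; apply: smooth_step_cvg => //.
    by rewrite lt_neqAle eq_sym y0.
  by rewrite lt_neqAle y1.
- by move=> k; apply: NDT => //; exact: smooth_step_DT.
Qed.

End Smooth.

(** * Primitives of square integrable functions *)

Section Primitive.
Variable R : realType.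
Local Notation mu := (@lebesgue_measure R).
Local Notation I := (@I01 R).
Implicit Types f g h k : R -> R.

Definition primr h (x : R) : R := \int[mu]_(t in (`[0, x] : set R)) h t.

Lemma subset_itv0 (x : R) : x <= 1 -> (`[0, x] : set R) `<=` I.
Proof. by move=> x1 y /=; rewrite /I01/= !in_itv/= => /andP[-> /le_trans]; apply. Qed.

Lemma subset_itv1 (x : R) : 0 <= x -> (`[x, 1] : set R) `<=` I.
Proof. by move=> x0 y /=; rewrite /I01/= !in_itv/= => /andP[/(le_trans x0) -> ->]. Qed.

Lemma L2r_intS (A : set R) h : measurable A -> A `<=` I -> L2r h ->
  mu.-integrable A (EFin \o h).
Proof.
move=> mA AI Lh; apply: integrableS (L2r_int Lh) => //; exact: measurable_I01.
Qed.

Lemma Rintegral_ipr (A : set R) h : measurable A -> A `<=` I -> L2r h ->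
  \int[mu]_(t in A) h t = ipr h (\1_A).
Proof.
move=> mA AI Lh; rewrite -[A in LHS](setIidr AI) Rintegral_mkcondr.
apply: eq_Rintegral => x _; rewrite patchE indicE.
by case: (x \in A); rewrite ?mulr1 ?mulr0.
Qed.

Lemma primr_ipr h x : x <= 1 -> L2r h -> primr h x = ipr h (\1_(`[0, x] : set R)).
Proof. by move=> x1 Lh; apply: Rintegral_ipr => //; exact: subset_itv0. Qed.

Lemma ipr_indic (A : set R) : measurable A -> A `<=` I ->
  ipr (\1_A) (\1_A) = fine (mu A).
Proof.
move=> mA AI; rewrite -Rintegral_ipr//; last exact: indic_L2r.
transitivity (\int[mu]_(t in A) (1 : R)); last by rewrite Rintegral_cst// mul1r.
by apply: eq_Rintegral => x xA; rewrite indicE xA.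
Qed.

Lemma primr_tail h x : 0 <= x -> x <= 1 -> L2r h ->
  \int[mu]_(t in (`[x, 1] : set R)) h t = primr h 1 - primr h x.
Proof.
move=> x0 x1 Lh; rewrite /primr.
have L1 := L2r_int Lh; rewrite /I01 in L1.
rewrite (Rintegral_itvB L1) ?bnd_simp// Rintegral_itv_obnd_cbnd//.
apply: L2r_intS => // y /=; rewrite /I01/= !in_itv/= => /andP[xy ->].
by rewrite (le_trans x0 (ltW xy)).
Qed.

Lemma primr0 h : primr h 0 = 0.
Proof. by rewrite /primr set_itv1 Rintegral_set1. Qed.

(** Hölder continuity of exponent 1/2, from Cauchy-Schwarz against the indicator of ]x, y]. *)
Lemma primr_diff h x y : 0 <= x -> x <= y -> y <= 1 -> L2r h ->
  (primr h y - primr h x) ^+ 2 <= ipr h h * (y - x).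
Proof.
move=> x0 xy y1 Lh; have x1 := le_trans xy y1.
have sub : (`]x, y] : set R) `<=` I.
  move=> z /=; rewrite /I01/= !in_itv/= => /andP[xz zy].
  by rewrite (le_trans x0 (ltW xz)) (le_trans zy y1).
have -> : primr h y - primr h x = ipr h (\1_(`]x, y] : set R)).
  rewrite -Rintegral_ipr//; apply: Rintegral_itvB; rewrite ?bnd_simp//.
  by apply: L2r_intS => //; exact: subset_itv0.
apply: le_trans (cauchy_schwarz Lh (indic_L2r _)) _ => //.
rewrite ipr_indic// lebesgue_measure_itv/= lte_fin.
case: ltP => [_|yx]; first by rewrite -EFinB.
by rewrite ler_wpM2l ?ipr_ge0//= subr_ge0.
Qed.

Lemma primr_sq_le h x : 0 <= x -> x <= 1 -> L2r h -> (primr h x) ^+ 2 <= ipr h h.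
Proof.
move=> x0 x1 Lh; have := primr_diff (lexx 0) x0 x1 Lh.
rewrite primr0 !subr0 => /le_trans; apply.
by rewrite -[leRHS]mulr1 ler_wpM2l ?ipr_ge0.
Qed.

Lemma L2r_primr h : L2r h -> L2r (primr h).
Proof.
(* From b^2 <= a follows |b| <= a + 1, which avoids a square root. *)
move=> Lh; apply: (@bounded_L2r _ _ (ipr h h + 1)).
  apply: subspace_continuous_measurable_fun; first exact: measurable_itv.
  exact: (parameterized_integral_continuous ler01 (L2r_int Lh)).
move=> x; rewrite /I01/= in_itv/= => /andP[x0 x1].
have := primr_sq_le x0 x1 Lh; have := ipr_ge0 h.
move: (ipr _ _) (primr _ _) => a b a0 b2; rewrite ler_norml; apply/andP; split; nra.
Qed.

Lemma Rintegral_I01_cst (c : R) : \int[mu]_(x in I) c = c.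
Proof.
rewrite Rintegral_cst; last exact: measurable_I01.
by rewrite [X in fine X]mu_I01 mulr1.
Qed.

Lemma ipr_primr_le h : L2r h -> ipr (primr h) (primr h) <= ipr h h.
Proof.
move=> Lh; have Lp := L2r_primr Lh.
have -> : ipr h h = \int[mu]_(x in I) (ipr h h).
  by rewrite Rintegral_I01_cst.
apply: le_Rintegral => //.
- exact: measurable_I01.
- exact: L2r_mul.
- exact: L2r_int (L2r_cst _).
- move=> x; rewrite /I01/= in_itv/= => /andP[x0 x1].
  by rewrite -expr2; exact: primr_sq_le.
Qed.

(** If the value at [x] is nonzero, the Hölder bound keeps it nonzero on an interval of positive
    length, which cannot lie in a null set. *)
Lemma primr_ae_cst0 (c : R) h : L2r h ->
  {ae mu, forall x, I x -> c + primr h x = 0} ->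
  forall x, I x -> c + primr h x = 0.
Proof.
move=> Lh [N [mN N0 sN]] x Ix; apply/eqP; apply: contraT => d0.
pose d := (c + primr h x) ^+ 2.
have d_gt0 : 0 < d by rewrite exprn_even_gt0.
have := Ix; rewrite /I01/= in_itv/= => /andP[x0 x1].
have K0 := ipr_ge0 h.
(* The bound 1/2 leaves room for an interval of length [e] inside [0, 1] on one side of [x]. The
   other bound makes [ipr h h * e < d]; the added 1 keeps the denominator positive when [ipr h h]
   vanishes. *)
pose e : R := Num.min (1 / 2) (d / (2 * (ipr h h + 1))).
have e0 : 0 < e.
  by rewrite lt_min; apply/andP; split; [lra|apply: divr_gt0 => //; lra].
have e1 : e <= 1 / 2 by rewrite ge_min lexx.
have ed : ipr h h * e < d.
  have : e <= d / (2 * (ipr h h + 1)) by rewrite ge_min lexx orbT.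
  rewrite ler_pdivlMr; last lra.
  nra.
have far y : 0 <= y -> y <= 1 -> `|x - y| <= e -> c + primr h y != 0.
  move=> y0 y1 xy; apply/eqP => dy.
  suff : d <= ipr h h * `|x - y|.
    apply/negP; rewrite -ltNge; apply: le_lt_trans ed.
    by rewrite ler_wpM2l.
  have -> : d = (primr h x - primr h y) ^+ 2 by rewrite /d; congr (_ ^+ 2); lra.
  have [le|lt] := leP y x.
    by rewrite ger0_norm ?subr_ge0//; exact: primr_diff.
  rewrite distrC gtr0_norm ?subr_gt0// -sqrrN opprB.
  by apply: primr_diff => //; exact: ltW.
have [a [b [ab0 aI bI [ax bx]]]] : exists a b : R,
    [/\ a < b, 0 <= a, b <= 1 & x - e <= a /\ b <= x + e].
  have [xs|xb] := leP x (1 / 2).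
    by exists x, (x + e); split; [|..|split]; lra.
  by exists (x - e), x; split; [|..|split]; lra.
have sub : (`[a, b] : set R) `<=` N.
  move=> y /=; rewrite in_itv/= => /andP[ay yb]; apply: sN => /= H.
  have y0 := le_trans aI ay; have y1 := le_trans yb bI.
  have /eqP := H (ltac:(by rewrite /I01/= in_itv/= y0 y1)).
  apply/negP; apply: far => //; rewrite ler_norml; lra.
have : (mu (`[a, b] : set R) <= mu N)%E by apply: le_measure; rewrite ?inE.
rewrite N0 lebesgue_measure_itv/= lte_fin ab0 -EFinB lee_fin; lra.
Qed.

(** The integral of h(x) k(t) over the triangle x <= t, in both orders. This is the source of
    integration by parts for primitives of merely square integrable functions, where no pointwise
    product rule is at hand. *)
Lemma fubini_triangle h k : L2r h -> L2r k ->
  ipr h (fun x => \int[mu]_(t in (`[x, 1] : set R)) k t) = ipr (primr h) k.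
Proof.
move=> Lh Lk.
pose T : measurableType _ := measurableTypeR R.
pose h' : T -> R := h \_ I; pose k' : T -> R := k \_ I.
have mI := @measurable_I01 R.
have ih : mu.-integrable setT (EFin \o h').
  by have := (@integrable_mkcond _ T R mu _ (EFin \o h) mI).1 (L2r_int Lh); rewrite restrict_EFin.
have ik : mu.-integrable setT (EFin \o k').
  by have := (@integrable_mkcond _ T R mu _ (EFin \o k) mI).1 (L2r_int Lk); rewrite restrict_EFin.
have mh : measurable_fun setT h' by have /measurable_EFinP := measurable_int mu ih.
have mk : measurable_fun setT k' by have /measurable_EFinP := measurable_int mu ik.
(* Extension by zero outside [0, 1] places the integrand on the whole plane; it is integrable
   because the product |h(x)| |k(y)| dominates it. *)
pose F (z : T * T) : \bar R :=
  (if (z.1 <= z.2)%R then h' z.1 * k' z.2 else 0)%:E.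
have mF : measurable_fun setT F.
  apply/measurable_EFinP; apply: measurable_fun_ifT => //.
    by apply: measurable_fun_ler; [exact: measurable_fst|exact: measurable_snd].
  by apply: measurable_funM; apply: measurableT_comp => //.
pose C := (\int[mu]_y `|(EFin \o k') y|)%E.
have C0 : (0 <= C)%E by exact: integral_ge0.
have Cfin : C \is a fin_num.
  by rewrite ge0_fin_numE//; case/integrableP: ik.
have Fle x y : (`|F (x, y)| <= `|h' x|%:E * `|(EFin \o k') y|)%E.
  rewrite /F/= -EFinM lee_fin -normrM; case: ifP => //.
  by rewrite normr0 normr_ge0.
have iF : (mu \x mu)%E.-integrable setT F.
  apply: (@integrable12ltyP _ _ T T R mu mu F mF).2.
  apply: (@le_lt_trans _ _ (\int[mu]_x (`|(EFin \o h') x| * C))%E).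
    apply: ge0_le_integral => //.
    - by move=> x _; exact: integral_ge0.
    - apply: (measurable_fun_fubini_tonelli_F (abse \o F)) => //.
        exact: measurableT_comp.
      by move=> z; exact: abse_ge0.
    - by apply: emeasurable_funM => //; apply: measurableT_comp => //; exact/measurable_EFinP.
    - move=> x _.
      rewrite -[leRHS]ge0_integralZl//; last first.
        by apply: measurableT_comp => //; exact/measurable_EFinP.
      apply: ge0_le_integral => //.
      + apply: measurableT_comp => //; exact: (measurableT_comp mF).
      + by apply: emeasurable_funM => //; apply: measurableT_comp => //; exact/measurable_EFinP.
  rewrite -(fineK Cfin) integralZr//; last exact: integrable_abse.
  have hfin : (\int[mu]_x `|(EFin \o h') x|)%E \is a fin_num.
    rewrite ge0_fin_numE; last exact: integral_ge0.
    by case/integrableP: ih.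
  by rewrite ltey_eq fin_numM.
have := Fubini iF.
have inner1 x : (\int[mu]_y F (x, y) =
   ((h \* (fun x => \int[mu]_(t in (`[x, 1] : set R)) k t)%R) \_ I x)%:E)%E.
  rewrite patchE; case: ifPn => [/set_mem Ix|nIx]; last first.
    apply: integral0_eq => y _; rewrite /F/= /h' patchE (negbTE nIx) mul0r.
    by case: ifP.
  have := Ix; rewrite /I01/= in_itv/= => /andP[x0 x1].
  have ikx := L2r_intS (measurable_itv _) (subset_itv1 x0) Lk.
  rewrite EFinM /Rintegral fineK; last exact: integrable_fin_num.
  rewrite -integralZl// [RHS]integral_mkcond; apply: eq_integral => y _.
  rewrite /F/= /h' /k' !patchE (mem_set Ix).
  have [xy|xy] /= := leP x y.
    have [y1|y1] := boolP (y \in I); last first.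
      rewrite memNset ?mulr0// => /(subset_itv1 x0) /mem_set.
      by rewrite (negbTE y1).
    rewrite mem_set// /= in_itv/= xy; move: y1 => /set_mem.
    by rewrite /I01/= in_itv/= => /andP[_ ->].
  by rewrite memNset//= in_itv/= leNgt xy.
have inner2 y : (\int[mu]_x F (x, y) = ((primr h \* k) \_ I y)%:E)%E.
  rewrite patchE; case: ifPn => [/set_mem Iy|nIy]; last first.
    apply: integral0_eq => x _; rewrite /F/= /k' patchE (negbTE nIy) mulr0.
    by case: ifP.
  have := Iy; rewrite /I01/= in_itv/= => /andP[y0 y1].
  have ihy := L2r_intS (measurable_itv _) (subset_itv0 y1) Lh.
  rewrite EFinM /primr /Rintegral fineK; last exact: integrable_fin_num.
  rewrite -integralZr// [RHS]integral_mkcond; apply: eq_integral => x _.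
  rewrite /F/= /h' /k' !patchE (mem_set Iy).
  have [xy|xy] /= := leP x y.
    have [x1|x1] := boolP (x \in I); last first.
      rewrite memNset ?mul0r// => /(subset_itv0 y1) /mem_set.
      by rewrite (negbTE x1).
    rewrite mem_set// /= in_itv/= xy; move: x1 => /set_mem.
    by rewrite /I01/= in_itv/= => /andP[-> _].
  rewrite memNset//= in_itv/= => /andP[_]; by rewrite leNgt xy.
under eq_integral do rewrite inner1.
under [in RHS]eq_integral do rewrite inner2.
move=> /(congr1 (@fine R)) E.
by rewrite /ipr Rintegral_mkcond [RHS]Rintegral_mkcond.
Qed.

End Primitive.

(** * The complex inner product *)

Section ComplexL2.
Variable R : realType.
Local Notation C := R[i].
Local Notation mu := (@lebesgue_measure R).
Local Notation I := (@I01 R).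

Implicit Types f g h : R -> C.

Definition mkc (a b : R -> R) : R -> C := fun x => Complex (a x) (b x).

Lemma mkcE (f : R -> C) :
  f = mkc (fun x => complex.Re (f x)) (fun x => complex.Im (f x)).
Proof. by apply/funext => x; rewrite /mkc; case: (f x). Qed.

Lemma cintE (A : set R) f : cint A f =
  Complex (\int[mu]_(x in A) complex.Re (f x)) (\int[mu]_(x in A) complex.Im (f x)).
Proof. by rewrite /cint /cR; simpc. Qed.

Lemma L2_mkc a b : L2 (mkc a b) <-> L2r a /\ L2r b.
Proof.
have mI := @measurable_I01 R.
split=> [[/= ma [mb fin]]|[La Lb]]; last first.
  split; first by case: La.
  split; first by case: Lb.
  have := integrableD mI (L2r_sq La) (L2r_sq Lb).
  by move=> /(integrable_lty mI).
have key (h : R -> R) : measurable_fun I h -> (forall x, h x ^+ 2 <= cabs2 (mkc a b x)) -> L2r h.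
  move=> mh hle; split=> //; apply: le_lt_trans fin.
  apply: ge0_le_integral => //.
  - by move=> x _; rewrite lee_fin sqr_ge0.
  - by apply/measurable_EFinP; exact: measurable_funX.
  - apply/measurable_EFinP; apply: measurable_funD; exact: measurable_funX.
  - by move=> x _; rewrite lee_fin.
split; apply: key => // x; rewrite /cabs2 /=; have := sqr_ge0 (a x); have := sqr_ge0 (b x); lra.
Qed.

Lemma L2E f : L2 f <->
  L2r (fun x => complex.Re (f x)) /\ L2r (fun x => complex.Im (f x)).
Proof. by rewrite {1}[f]mkcE L2_mkc. Qed.

Lemma L2norm2_mkc a b : L2r a -> L2r b ->
  L2norm2 (mkc a b) = ipr a a + ipr b b.
Proof.
move=> La Lb; rewrite /ipr -RintegralD ?L2r_mul//; exact: measurable_I01.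
Qed.

Lemma L2norm2_ge0 (f : R -> C) : 0 <= L2norm2 f.
Proof. by apply: Rintegral_ge0 => x _; rewrite addr_ge0 ?sqr_ge0. Qed.

Lemma aform_mkc a b c d : L2r a -> L2r b -> L2r c -> L2r d ->
  aform (mkc a b) (mkc c d) =
  Complex (ipr a c + ipr b d) (ipr b c - ipr a d).
Proof.
move=> La Lb Lc Ld; have mI := @measurable_I01 R.
rewrite /aform /cint01 cintE /ipr -RintegralD ?L2r_mul// -RintegralB ?L2r_mul//.
congr Complex; apply: eq_Rintegral => x _ /=.
  by rewrite mulrN opprK.
by rewrite mulrN addrC.
Qed.

Lemma L2D f g : L2 f -> L2 g -> L2 (fun x => f x + g x : C).
Proof.
rewrite [f]mkcE [g]mkcE => /L2_mkc[La Lb] /L2_mkc[Lc Ld].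
by apply/(L2_mkc (fun x => _ + _) (fun x => _ + _)); split; apply: L2rD.
Qed.

Lemma L2Z (z : C) f : L2 f -> L2 (fun x => z * f x).
Proof.
rewrite [f]mkcE; case: z => s t /L2_mkc[La Lb].
apply/(L2_mkc (fun x => _ - _) (fun x => _ + _)); split.
  by apply: L2rB; exact: L2rZ.
by apply: L2rD; exact: L2rZ.
Qed.

Lemma L2B f g : L2 f -> L2 g -> L2 (fun x => f x - g x : C).
Proof.
move=> Lf /(L2Z (-1)) Lg; have := L2D Lf Lg.
by congr L2; apply/funext => x; rewrite mulN1r.
Qed.

Lemma L2N f : L2 f -> L2 (fun x => - f x : C).
Proof. by move=> /(L2Z (-1)); congr L2; apply/funext => x; rewrite mulN1r. Qed.

Lemma L2_cR (e : R -> R) : L2r e -> L2 (fun x => cR (e x)).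
Proof. by move=> Le; apply/L2_mkc; split=> //; exact: L2r_cst. Qed.

Lemma L2_cst (z : C) : L2 (fun=> z).
Proof. by case: z => a b; apply/(L2_mkc (fun=> a) (fun=> b)); split; exact: L2r_cst. Qed.

Lemma eq_L2 f g : (forall x, I x -> f x = g x) -> L2 f -> L2 g.
Proof.
move=> fg /L2E[La Lb]; apply/L2E; split.
  by apply: eq_L2r La => x Ix; rewrite fg.
by apply: eq_L2r Lb => x Ix; rewrite fg.
Qed.

Lemma eq_aform f g (f' g' : R -> C) : (forall x, I x -> f x = f' x) ->
  (forall x, I x -> g x = g' x) -> aform f g = aform f' g'.
Proof.
move=> ff gg; rewrite /aform /cint01 !cintE; congr Complex;
  by apply: eq_Rintegral => x /set_mem Ix; rewrite ff// gg.
Qed.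

Lemma aformDl f g h : L2 f -> L2 g -> L2 h ->
  aform (fun x => f x + g x) h = aform f h + aform g h.
Proof.
rewrite [f]mkcE [g]mkcE [h]mkcE => /L2_mkc[Lf1 Lf2] /L2_mkc[Lg1 Lg2] /L2_mkc[Lh1 Lh2].
rewrite [LHS](aform_mkc (L2rD Lf1 Lg1) (L2rD Lf2 Lg2) Lh1 Lh2) !aform_mkc//.
by simpc; rewrite !ipDl//; congr Complex; ring.
Qed.

Lemma aformZl (z : C) f h : L2 f -> L2 h ->
  aform (fun x => z * f x) h = z * aform f h.
Proof.
rewrite [f]mkcE [h]mkcE; case: z => s t /L2_mkc[Lf1 Lf2] /L2_mkc[Lh1 Lh2].
rewrite [LHS](aform_mkc (L2rB (L2rZ s Lf1) (L2rZ t Lf2))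
  (L2rD (L2rZ s Lf2) (L2rZ t Lf1)) Lh1 Lh2) !aform_mkc//.
have ipBl u v w : L2r u -> L2r v -> L2r w ->
    ipr (fun x => s * u x - t * v x) w = s * ipr u w - t * ipr v w.
  move=> Lu Lv Lw; have := ipDl (L2rZ s Lu) (L2rZ (- t) Lv) Lw.
  rewrite !ipZl// mulNr => <-; congr ipr; apply/funext => x; by rewrite mulNr.
by simpc; rewrite !ipBl// !(ipDl (L2rZ s Lf2) (L2rZ t Lf1))// !ipZl//; congr Complex; ring.
Qed.

Lemma aformC f g : L2 f -> L2 g -> aform g f = conjc (aform f g).
Proof.
rewrite [f]mkcE [g]mkcE => /L2_mkc[Lf1 Lf2] /L2_mkc[Lg1 Lg2].
rewrite !aform_mkc//; simpc; congr Complex.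
  by rewrite [in LHS]ipC [X in _ + X]ipC.
by rewrite opprB [in LHS]ipC [X in _ - X]ipC.
Qed.

End ComplexL2.

(** * Bounded antilinear functionals on L^2 and their kernels *)

Section Antilinear.
Variable R : realType.
Local Notation C := R[i].
Local Notation mu := (@lebesgue_measure R).
Local Notation I := (@I01 R).
Implicit Types f g h : R -> C.
Implicit Types z w : C.

Lemma conjcD z w : conjc (z + w) = conjc z + conjc w.
Proof. by case: z w => a b [c d] /=; rewrite opprD. Qed.

Lemma conjcM z w : conjc (z * w) = conjc z * conjc w.
Proof. by case: z w => a b [c d]; simpc; congr Complex; ring. Qed.

Lemma conjc_cR (r : R) : conjc (cR r) = cR r.
Proof. by rewrite /cR/= oppr0. Qed.

Lemma cRM (r s : R) : cR (r * s) = cR r * cR s.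
Proof. exact: (rmorphM (real_complex R)). Qed.

Lemma cRD (r s : R) : cR (r + s) = cR r + cR s.
Proof. exact: (rmorphD (real_complex R)). Qed.

Lemma cabs2_ge0 z : 0 <= cabs2 z.
Proof. by rewrite addr_ge0 ?sqr_ge0. Qed.

Lemma cabs2_eq0 z : cabs2 z <= 0 -> z = 0.
Proof.
case: z => a b; rewrite /cabs2/= => H.
have a0 : a = 0 by have := sqr_ge0 a; have := sqr_ge0 b; nra.
have b0 : b = 0 by have := sqr_ge0 a; have := sqr_ge0 b; nra.
by rewrite a0 b0.
Qed.

Lemma cabs2_small z : (forall e : R, 0 < e -> cabs2 z <= e) -> z = 0.
Proof.
move=> H; apply: cabs2_eq0; rewrite leNgt; apply/negP => z0.
by have := H (cabs2 z / 2) (ltac:(lra)); lra.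
Qed.

Lemma cabs2D z w : cabs2 (z + w) <= 2 * cabs2 z + 2 * cabs2 w.
Proof.
case: z w => a b [c d]; rewrite /cabs2/=.
have := sqr_ge0 (a - c); have := sqr_ge0 (b - d); nra.
Qed.

Lemma cabs2M z w : cabs2 (z * w) = cabs2 z * cabs2 w.
Proof. by case: z w => a b [c d]; rewrite /cabs2/=; ring. Qed.

Lemma cabs2N z : cabs2 (- z) = cabs2 z.
Proof. by case: z => a b; rewrite /cabs2/= !sqrrN. Qed.

Lemma aformDr f g h : L2 f -> L2 g -> L2 h ->
  aform h (fun x => f x + g x) = aform h f + aform h g.
Proof.
move=> Lf Lg Lh; have Lfg := L2D Lf Lg.
by rewrite aformC// aformDl// conjcD -!aformC.
Qed.

Lemma aformZr z f h : L2 f -> L2 h ->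
  aform h (fun x => z * f x) = conjc z * aform h f.
Proof.
move=> Lf Lh; have Lz := L2Z z Lf.
by rewrite aformC// aformZl// conjcM -aformC.
Qed.

Lemma aformNl f h : L2 f -> L2 h -> aform (fun x => - f x) h = - aform f h.
Proof.
move=> Lf Lh; rewrite -mulN1r -aformZl//.
by apply: eq_aform => // x _; rewrite mulN1r.
Qed.

Lemma aformBl f g h : L2 f -> L2 g -> L2 h ->
  aform (fun x => f x - g x) h = aform f h - aform g h.
Proof. by move=> Lf Lg Lh; rewrite -aformNl// -aformDl//; exact: L2N. Qed.

Lemma aformNr f h : L2 f -> L2 h -> aform h (fun x => - f x) = - aform h f.
Proof.
move=> Lf Lh; have E : conjc (-1) = -1 :> C by rewrite /= oppr0.
rewrite -mulN1r -E -aformZr//.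
by apply: eq_aform => // x _; rewrite mulN1r.
Qed.

Lemma aformBr f g h : L2 f -> L2 g -> L2 h ->
  aform h (fun x => f x - g x) = aform h f - aform h g.
Proof. by move=> Lf Lg Lh; rewrite -aformNr// -aformDr//; exact: L2N. Qed.

(** Four real Cauchy-Schwarz inequalities, one for each pair of real and imaginary parts. The factor
    4 is not sharp; only boundedness matters. *)
Lemma aform_bound f g : L2 f -> L2 g ->
  cabs2 (aform f g) <= 4 * L2norm2 f * L2norm2 g.
Proof.
rewrite [f]mkcE [g]mkcE => /L2_mkc[Lf1 Lf2] /L2_mkc[Lg1 Lg2].
rewrite aform_mkc// !L2norm2_mkc// /cabs2/=.
have := cauchy_schwarz Lf1 Lg1; have := cauchy_schwarz Lf2 Lg2.
have := cauchy_schwarz Lf1 Lg2; have := cauchy_schwarz Lf2 Lg1.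
move: (ipr_ge0 (fun x => complex.Re (f x))) (ipr_ge0 (fun x => complex.Im (f x))).
move: (ipr_ge0 (fun x => complex.Re (g x))) (ipr_ge0 (fun x => complex.Im (g x))).
move: (ipr _ _) (ipr _ _) (ipr _ _) (ipr _ _) => c d a b.
move: (ipr _ _) (ipr _ _) (ipr _ _) (ipr _ _) => p q r s.
move=> c0 d0 a0 b0 H1 H2 H3 H4.
have := sqr_ge0 (p - q); have := sqr_ge0 (r + s).
have := sqr_ge0 (p + q); have := sqr_ge0 (r - s).
have := sqr_ge0 (p + r); have := sqr_ge0 (q - s).
have := sqr_ge0 (p - r); have := sqr_ge0 (q + s).
have := sqr_ge0 (p - s); have := sqr_ge0 (q + r).
have := sqr_ge0 (p + s); have := sqr_ge0 (q - r).
have := mulr_ge0 a0 c0; have := mulr_ge0 a0 d0.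
have := mulr_ge0 b0 c0; have := mulr_ge0 b0 d0.
rewrite !expr2 in H1 H2 H3 H4 *; lra.
Qed.

Lemma L2norm2_aform f : L2 f -> aform f f = cR (L2norm2 f).
Proof.
rewrite [f]mkcE => /L2_mkc[Lf1 Lf2]; rewrite aform_mkc// L2norm2_mkc//.
by rewrite /cR [X in X - _]ipC subrr.
Qed.

Lemma L2norm2Z z f : L2 f -> L2norm2 (fun x => z * f x) = cabs2 z * L2norm2 f.
Proof.
move=> Lf; have Lz := L2Z z Lf.
have := L2norm2_aform Lz; rewrite aformZl// aformZr// mulrA L2norm2_aform//.
have -> : z * conjc z = cR (cabs2 z).
  by case: (z) => a b; rewrite /cabs2 /cR; simpc; congr Complex; ring.
by rewrite -cRM => -[].
Qed.

Lemma L2norm2D f g : L2 f -> L2 g ->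
  L2norm2 (fun x => f x + g x) <= 2 * L2norm2 f + 2 * L2norm2 g.
Proof.
rewrite [f]mkcE [g]mkcE => /L2_mkc[Lf1 Lf2] /L2_mkc[Lg1 Lg2].
rewrite [leLHS](L2norm2_mkc (L2rD Lf1 Lg1) (L2rD Lf2 Lg2)) !L2norm2_mkc//.
have := ipr_le_sum Lf1 Lg1; have := ipr_le_sum Lf2 Lg2; lra.
Qed.

Lemma eq_L2norm2 f g : (forall x, I x -> f x = g x) -> L2norm2 f = L2norm2 g.
Proof. by move=> fg; apply: eq_Rintegral => x /set_mem Ix; rewrite fg. Qed.

Lemma L2norm2_eq0_ae f : L2 f -> L2norm2 f = 0 -> {ae mu, forall x, I x -> f x = 0}.
Proof.
rewrite [f]mkcE => /L2_mkc[La Lb]; rewrite L2norm2_mkc// => E.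
have a0 := ipr_ge0 (fun x => complex.Re (f x)).
have b0 := ipr_ge0 (fun x => complex.Im (f x)).
have Ha := ipr0_ae La (ltac:(lra)); have Hb := ipr0_ae Lb (ltac:(lra)).
by apply: ae_imp2 Ha Hb => x Ea Eb Ix; rewrite /mkc Ea// Eb.
Qed.

Lemma aform_ae f g h : L2 f -> L2 g -> L2 h ->
  {ae mu, forall x, I x -> f x = g x} -> aform f h = aform g h.
Proof.
rewrite [f]mkcE [g]mkcE [h]mkcE.
move=> /L2_mkc[Lf1 Lf2] /L2_mkc[Lg1 Lg2] /L2_mkc[Lh1 Lh2] fg.
rewrite !aform_mkc//.
have E1 : {ae mu, forall x, I x -> complex.Re (f x) = complex.Re (g x)}.
  by apply: ae_imp fg => x H Ix; have [->] := H Ix.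
have E2 : {ae mu, forall x, I x -> complex.Im (f x) = complex.Im (g x)}.
  by apply: ae_imp fg => x H Ix; have [_ ->] := H Ix.
by congr Complex; congr (_ + _); try congr (- _); exact: ipr_eq_ae.
Qed.

(** An identity known on few test functions is extended to L^2 by taking for [T] the difference of
    its two sides: the kernel is closed, so density applies to it. *)
Definition bdd_antilinear (T : (R -> C) -> C) : Prop :=
  (forall a b f g, L2 f -> L2 g ->
     T (fun x => a * f x + b * g x) = conjc a * T f + conjc b * T g) /\
  (exists M : R, forall f, L2 f -> cabs2 (T f) <= M * L2norm2 f).

Lemma bdd_antilinear_aform f : L2 f -> bdd_antilinear (aform f).
Proof.
move=> Lf; split=> [a b g h Lg Lh|].
  by rewrite aformDr ?aformZr//; exact: L2Z.
by exists (4 * L2norm2 f) => g Lg; exact: aform_bound.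
Qed.

Lemma bdd_antilinearB (T S : (R -> C) -> C) :
  bdd_antilinear T -> bdd_antilinear S -> bdd_antilinear (fun f => T f - S f).
Proof.
move=> [lT [M bT]] [lS [N bS]]; split=> [a b f g Lf Lg|].
  by rewrite lT// lS//; ring.
exists (2 * M + 2 * N) => f Lf.
apply: le_trans (cabs2D _ _) _; rewrite cabs2N.
have := bT f Lf; have := bS f Lf; nra.
Qed.

Lemma bdd_antilinear_kernel (T : (R -> C) -> C) : bdd_antilinear T ->
  L2r_closed_subspace (fun e => T (fun x => cR (e x)) = 0).
Proof.
move=> [lT [M bT]].
(* No sign of [M] is assumed; testing on the constant 1, of norm one, shows that it is
   nonnegative. *)
have M0 : 0 <= M * L2norm2 (fun=> 1 : C).
  exact: le_trans (cabs2_ge0 _) (bT _ (L2_cst 1)).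
have n1 : L2norm2 (fun=> 1 : C) = 1.
  rewrite /L2norm2 (_ : (fun _ => _) = fun=> 1); last first.
    by apply/funext => x; rewrite /cabs2/= expr1n expr0n/= addr0.
  exact: Rintegral_I01_cst.
rewrite n1 mulr1 in M0.
split=> [a b f g Lf Lg Tf Tg|f Lf H].
  have := lT (cR a) (cR b) _ _ (L2_cR Lf) (L2_cR Lg); rewrite Tf Tg !mulr0 addr0 => <-.
  by congr T; apply/funext => x; rewrite cRD !cRM.
apply: cabs2_small => e e0.
(* As [T] vanishes on the approximant, |T f|^2 is at most [M] times the squared distance, hence at
   most [e]; the added 1 covers [M = 0]. *)
have [] := H (e / (M + 1)); first by apply: divr_gt0 => //; lra.
move=> g [Lg Tg]; rewrite ltr_pdivlMr; last lra.
have Lfg := L2rB Lf Lg.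
have -> : T (fun x => cR (f x)) = T (fun x => cR (f x - g x)).
  have := lT 1 1 _ _ (L2_cR Lfg) (L2_cR Lg); rewrite Tg mulr0 addr0.
  rewrite rmorph1 mul1r => <-; congr T; apply/funext => x.
  by rewrite !mul1r -cRD subrK.
have := bT _ (L2_cR Lfg).
have -> : L2norm2 (fun x => cR (f x - g x)) = ipr (fun x => f x - g x) (fun x => f x - g x).
  rewrite [LHS](L2norm2_mkc Lfg (L2r_cst 0)) [X in _ + X]ipr0l ?addr0//.
  exact: L2r_cst.
have := ipr_ge0 (fun x => f x - g x); move: (ipr _ _) (cabs2 _) => u v; nra.
Qed.

Lemma bdd_antilinear_real0 (T : (R -> C) -> C) : bdd_antilinear T ->
  (forall e, L2r e -> T (fun x => cR (e x)) = 0) -> forall f, L2 f -> T f = 0.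
Proof.
move=> [lT _] H f /L2E[La Lb].
have := lT 1 (Complex 0 1) _ _ (L2_cR La) (L2_cR Lb).
rewrite !H// !mulr0 addr0 => <-; congr T; apply/funext => x.
by case: (f x) => a b; rewrite /cR/= mul1r; simpc.
Qed.

Lemma bdd_antilinear_DT0 (T : (R -> C) -> C) : bdd_antilinear T ->
  (forall phi, L2 phi -> DT phi -> T phi = 0) -> forall f, L2 f -> T f = 0.
Proof.
move=> bT H; apply: bdd_antilinear_real0 => // e Le.
apply: (closed_subspace_DT_full (bdd_antilinear_kernel bT)) => // d Ld Dd.
by apply: H => //; exact: L2_cR.
Qed.

Lemma bdd_antilinear_itv0 (T : (R -> C) -> C) : bdd_antilinear T ->
  (forall x : R, 0 <= x -> x <= 1 ->
     T (fun y => cR (\1_(`[0, x] : set R) y)) = 0) ->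
  forall f, L2 f -> T f = 0.
Proof.
move=> bT H; apply: bdd_antilinear_real0 => // e Le.
exact: (closed_subspace_full (bdd_antilinear_kernel bT)).
Qed.

End Antilinear.

(** * Integration by parts in H^1 *)

Section Sobolev.
Variable R : realType.
Local Notation C := R[i].
Local Notation mu := (@lebesgue_measure R).
Local Notation I := (@I01 R).
Implicit Types f g h u v w z phi psi : R -> C.
Implicit Types a b c d : C.

Lemma I01_P (x : R) : (x \in I) = (0 <= x <= 1).
Proof. by apply/idP/idP; rewrite inE /I01/= in_itv. Qed.

Lemma I01_0 : (0 : R) \in I. Proof. by rewrite I01_P lexx ler01. Qed.
Lemma I01_1 : (1 : R) \in I. Proof. by rewrite I01_P lexx ler01. Qed.

Definition primc v (x : R) : C := cint (`[0, x] : set R) v.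

Lemma primc_mkc (a b : R -> R) : primc (mkc a b) = mkc (primr a) (primr b).
Proof. by apply/funext => x; rewrite /primc cintE. Qed.

Lemma cint01_primc v : cint01 v = primc v 1.
Proof. by []. Qed.

Lemma L2_primc v : L2 v -> L2 (primc v).
Proof.
rewrite [v]mkcE => /L2_mkc[La Lb]; rewrite primc_mkc; apply/L2_mkc.
by split; exact: L2r_primr.
Qed.

Lemma primc0 v : primc v 0 = 0.
Proof. by rewrite [v]mkcE primc_mkc /mkc !primr0. Qed.

Lemma L2norm2_primc_le v : L2 v -> L2norm2 (primc v) <= L2norm2 v.
Proof.
rewrite [v]mkcE => /L2_mkc[La Lb]; rewrite primc_mkc.
rewrite !L2norm2_mkc//; try exact: L2r_primr.
by apply: lerD; exact: ipr_primr_le.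
Qed.

Lemma primc_aform v (x : R) : x <= 1 -> L2 v ->
  primc v x = aform v (fun y => cR (\1_(`[0, x] : set R) y)).
Proof.
move=> x1; rewrite [v]mkcE => /L2_mkc[La Lb]; rewrite primc_mkc.
have Li : L2r (\1_(`[0, x] : set R)) by apply: indic_L2r; exact: measurable_itv.
have L0 := L2r_cst (0 : R).
rewrite [RHS](aform_mkc La Lb Li L0) /mkc !primr_ipr//.
by rewrite ![ipr _ (fun=> 0)]ipC !ipr0l// addr0 subr0.
Qed.

Lemma primc_comb a b v w (x : R) : x \in I -> L2 v -> L2 w ->
  primc (fun y => a * v y + b * w y) x = a * primc v x + b * primc w x.
Proof.
rewrite I01_P => /andP[_ x1] Lv Lw; have Lav := L2Z a Lv; have Lbw := L2Z b Lw.
have Li : L2 (fun y => cR (\1_(`[0, x] : set R) y)).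
  by apply: L2_cR; apply: indic_L2r; exact: measurable_itv.
have Lc := L2D Lav Lbw.
by rewrite !primc_aform// aformDl// !aformZl.
Qed.

Lemma primc_tail v (x : R) : x \in I -> L2 v ->
  cint (`[x, 1] : set R) v = primc v 1 - primc v x.
Proof.
rewrite I01_P => /andP[x0 x1]; rewrite [v]mkcE => /L2_mkc[La Lb].
by rewrite primc_mkc cintE /= !primr_tail.
Qed.

Lemma ipr_primr_parts (h k : R -> R) : L2r h -> L2r k ->
  ipr h (primr k) + ipr (primr h) k = primr h 1 * primr k 1.
Proof.
move=> Lh Lk; rewrite -fubini_triangle//.
have Lp := L2r_primr Lk; have L1 := L2r_cst (primr k 1).
have -> : ipr h (fun x => \int[mu]_(t in (`[x, 1] : set R)) k t) =
   ipr (fun x => primr k 1 + (-1) * primr k x) h.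
  rewrite ipC; apply: eq_Rintegral => x; rewrite I01_P => /andP[x0 x1].
  by rewrite primr_tail// mulN1r.
rewrite ipDl ?ipZl//; last exact: L2rZ.
rewrite [ipr (primr k) h]ipC mulN1r addrCA subrr addr0.
transitivity (ipr (fun x => primr k 1 * 1) h).
  by congr ipr; apply/funext => x; rewrite mulr1.
rewrite ipZl//; last exact: L2r_cst.
rewrite mulrC; congr (_ * _); apply: eq_Rintegral => x _.
by rewrite mul1r.
Qed.

Lemma aform_primc_parts v w : L2 v -> L2 w ->
  aform v (primc w) + aform (primc v) w = primc v 1 * conjc (primc w 1).
Proof.
rewrite [v]mkcE [w]mkcE => /L2_mkc[La Lb] /L2_mkc[Lc Ld]; rewrite !primc_mkc.
have La' := L2r_primr La; have Lb' := L2r_primr Lb.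
have Lc' := L2r_primr Lc; have Ld' := L2r_primr Ld.
rewrite !aform_mkc// /mkc.
have := ipr_primr_parts La Lc; have := ipr_primr_parts Lb Ld.
have := ipr_primr_parts Lb Lc; have := ipr_primr_parts La Ld.
move: (primr _ 1) (primr _ 1) (primr _ 1) (primr _ 1) => s t q r.
do 8 move: (ipr _ _) => ?.
by move=> E1 E2 E3 E4; simpc; congr Complex; lra.
Qed.

Lemma H1repE u v c : H1rep u v c -> forall x : R, x \in I -> u x = c + primc v x.
Proof. by case. Qed.

Lemma H1rep_derivative_L2 u v c : H1rep u v c -> L2 v.
Proof. by case. Qed.

Lemma H1rep_L2 u v c : H1rep u v c -> L2 u.
Proof.
move=> [Lv uE]; apply: eq_L2 (L2D (L2_cst c) (L2_primc Lv)) => x /mem_set Ix.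
by rewrite uE.
Qed.

Lemma H1rep0 u v c : H1rep u v c -> u 0 = c.
Proof. by move=> H; rewrite (H1repE H I01_0) primc0 addr0. Qed.

Lemma H1rep_comb a b u v c w z d : H1rep u v c -> H1rep w z d ->
  H1rep (fun x => a * u x + b * w x) (fun x => a * v x + b * z x) (a * c + b * d).
Proof.
move=> [Lv uE] [Lz wE]; split; first by apply: L2D; exact: L2Z.
move=> x Ix; have := primc_comb a b Ix Lv Lz; rewrite /primc uE// wE// => ->; ring.
Qed.

Lemma eq_H1rep u u' v c : (forall x, I x -> u x = u' x) ->
  H1rep u v c -> H1rep u' v c.
Proof. by move=> uu [Lv uE]; split=> // x Ix; rewrite -uu ?uE//; exact: set_mem. Qed.

Lemma H1rep_cst a : H1rep (fun=> a) (fun=> 0) a.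
Proof.
have L0 := @L2_cst R 0; split=> // x Ix.
have := primc_comb 0 0 Ix L0 L0; rewrite !mul0r !addr0 /primc => ->.
by rewrite addr0.
Qed.

Lemma H1rep_primc v : L2 v -> H1rep (primc v) v 0.
Proof. by move=> Lv; split=> // x _; rewrite add0r. Qed.

Lemma aform_cst1 v : L2 v -> aform v (fun=> 1) = primc v 1.
Proof.
move=> Lv; rewrite primc_aform//; apply: eq_aform => // x Ix.
by rewrite indicE mem_set.
Qed.

Lemma integration_by_parts_H1 u v c w z d : H1rep u v c -> H1rep w z d ->
  aform v w + aform u z = u 1 * conjc (w 1) - u 0 * conjc (w 0).
Proof.
move=> Hu Hw; have Lv := H1rep_derivative_L2 Hu; have Lz := H1rep_derivative_L2 Hw.
have Lpv := L2_primc Lv; have Lpz := L2_primc Lz.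
have L1 := @L2_cst R 1.
rewrite (H1rep0 Hu) (H1rep0 Hw) (H1repE Hu I01_1) (H1repE Hw I01_1).
have -> : aform u z = c * conjc (primc z 1) + aform (primc v) z.
  rewrite (@eq_aform _ u z (fun x => c * 1 + primc v x) z)//; last first.
    by move=> x /mem_set Ix; rewrite (H1repE Hu Ix) mulr1.
  rewrite aformDl//; last exact: L2Z.
  by rewrite aformZl// (aformC Lz L1) aform_cst1.
have -> : aform v w = conjc d * primc v 1 + aform v (primc z).
  rewrite (@eq_aform _ v w v (fun x => d * 1 + primc z x))//; last first.
    by move=> x /mem_set Ix; rewrite (H1repE Hw Ix) mulr1.
  rewrite aformDr//; last exact: L2Z.
  by rewrite aformZr// aform_cst1.
have -> : aform v (primc z) =
    primc v 1 * conjc (primc z 1) - aform (primc v) z.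
  by rewrite -aform_primc_parts// addrK.
rewrite conjcD; ring.
Qed.

Definition pw (k : nat) (x : R) : C := cR ((1 - x) ^+ k).

Lemma continuous_pow1B (k : nat) (s : R) :
  continuous (fun t : R => s * (1 - t) ^+ k : R).
Proof.
move=> x; apply: cvgM; first exact: cvg_cst.
apply: (@continuous_comp R R R (fun t => 1 - t) (fun y => y ^+ k) x);
  last exact: exprn_continuous.
by apply: cvgB; [exact: cvg_cst|exact: cvg_id].
Qed.

Lemma L2r_pow1B (k : nat) (s : R) : L2r (fun t : R => s * (1 - t) ^+ k).
Proof.
apply: (@bounded_L2r _ _ `|s|).
  by apply: measurable_funTS; apply: continuous_measurable_fun; exact: continuous_pow1B.
move=> x /mem_set; rewrite I01_P => /andP[x0 x1].
rewrite normrM -[leRHS]mulr1 ler_wpM2l// normrX exprn_ile1// ger0_norm; lra.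
Qed.

Lemma L2_pw k : L2 (pw k).
Proof.
apply: L2_cR; apply: eq_L2r (L2r_pow1B k 1) => x _; exact: mul1r.
Qed.

Lemma primr_pow1B (k : nat) (x : R) : 0 <= x ->
  primr (fun t => - k.+1%:R * (1 - t) ^+ k) x = (1 - x) ^+ k.+1 - 1.
Proof.
rewrite le_eqVlt => /predU1P[<-|x0]; first by rewrite primr0 subr0 expr1n subrr.
rewrite /primr /Rintegral.
have dF (y : R) : is_derive y 1 (fun t : R => (1 - t) ^+ k.+1) (- k.+1%:R * (1 - y) ^+ k).
  have dg : is_derive y (1 : R) (fun t : R => 1 - t) (-1).
    have := is_deriveB (is_derive_cst (1 : R) y (1 : R)) (is_derive_id y (1 : R)).
    by rewrite sub0r.
  have := is_deriveX k.+1 dg; rewrite exprfctE => H; apply: (is_derive_eq H).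
  by rewrite /GRing.scale/= mulrN1 mulNr.
have cF : continuous (fun t : R => (1 - t) ^+ k.+1 : R).
  move=> y; apply: differentiable_continuous; apply/derivable1_diffP.
  exact: (@ex_derive _ _ _ _ _ _ _ (dF y)).
rewrite (@continuous_FTC2 _ _ (fun t => (1 - t) ^+ k.+1) 0 x)//.
- by rewrite subr0 expr1n.
- by apply: continuous_subspaceT; exact: continuous_pow1B.
- split.
  + by move=> y _; exact: (@ex_derive _ _ _ _ _ _ _ (dF y)).
  + by apply: cvg_at_right_filter; exact: cF.
  + by apply: cvg_at_left_filter; exact: cF.
- by move=> y _; rewrite derive1E; exact: (@derive_val _ _ _ _ _ _ _ (dF y)).
Qed.

Lemma H1rep_pw k : H1rep (pw k.+1) (fun x => - cR k.+1%:R * pw k x) 1.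
Proof.
have E : (fun x => - cR k.+1%:R * pw k x) =
    mkc (fun t => - k.+1%:R * (1 - t) ^+ k) (fun=> 0).
  apply/funext => x; rewrite /pw /mkc /cR; simpc.
  by [].
split; first by apply: L2Z; exact: L2_pw.
move=> x Ix; rewrite -[cint _ _]/(primc _ x) E primc_mkc /mkc.
have := I01_P x; rewrite Ix => /esym/andP[x0 x1].
rewrite primr_pow1B// primr_ipr ?ipr0l//; [|exact: indic_L2r|exact: L2r_cst].
by rewrite /pw /cR; simpc; congr Complex; ring.
Qed.

End Sobolev.

(** * The operators J_n and P_n *)

Section Distributions.
Variable R : realType.
Local Notation C := R[i].
Local Notation mu := (@lebesgue_measure R).
Local Notation I := (@I01 R).
Implicit Types f g h u v w p phi psi : R -> C.
Implicit Types a b c d : C.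
Implicit Types F : (R -> C) -> C.

Lemma cR_nat_pw1 m : cR m.+1%:R * primc (@pw R m) 1 = 1.
Proof.
have H := H1repE (H1rep_pw R m) (I01_1 R).
have Lp := L2_pw R m.
have := primc_comb (- cR m.+1%:R) 0 (I01_1 R) Lp Lp.
rewrite mul0r addr0 => E.
have {}E : primc (fun x => - cR m.+1%:R * pw m x) 1 = - cR m.+1%:R * primc (@pw R m) 1.
  rewrite -E; congr (primc _ 1); apply/funext => x; by rewrite mul0r addr0.
move: H; rewrite E {1}/pw subrr expr0n/= => /esym/eqP.
by rewrite mulNr subr_eq0 => /eqP <-.
Qed.

Lemma pw1 k : @pw R k.+1 1 = 0.
Proof. by rewrite /pw subrr expr0n. Qed.

Lemma pw0 k : @pw R k 0 = 1.
Proof. by rewrite /pw subr0 expr1n. Qed.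

Lemma conjc_pw k (x : R) : conjc (pw k x) = pw k x.
Proof. exact: conjc_cR. Qed.

Lemma mukE k f : muk k f = aform f (@pw R k).
Proof.
rewrite /muk /aform; congr cint01; apply/funext => x.
by rewrite conjc_pw mulrC.
Qed.

(** With m = n - 1 this is the origin of the factor 2n - 1 in gamma. *)
Lemma aform_pw_pw m : cR (m + m).+1%:R * aform (@pw R m) (@pw R m) = 1.
Proof.
rewrite -[RHS](cR_nat_pw1 (m + m)); congr (_ * _).
rewrite -aform_cst1; last exact: L2_pw.
rewrite /aform; congr cint01; apply/funext => x.
by rewrite conjc_pw /pw -cRM -exprD /= oppr0 mulr1.
Qed.

Lemma DT_L2 phi : DT phi -> L2 phi.
Proof.
move=> [_ dphi].
have key (e : R -> R) : (forall x : R, derivable e x 1) -> L2r e.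
  move=> de; have ce : continuous e.
    by move=> x; apply: differentiable_continuous; apply/derivable1_diffP.
  apply: L2r_of_sq.
    by apply: measurable_funTS; exact: continuous_measurable_fun.
  apply: continuous_compact_integrable; first exact: segment_compact.
  apply: continuous_subspaceT.
  have -> : (fun x => e x ^+ 2) = (fun x => e x * e x).
    by apply/funext => x; rewrite expr2.
  by move=> x; apply: cvgM; exact: ce.
apply/L2E; split; apply: key => x; have [] := dphi 0%N x; by [].
Qed.

(** The derivative of [Jn m.+1 phi]. Writing n as [m.+1] turns the exponent n - 1 into [m], without
    truncated subtraction. *)
Definition dJn m phi (x : R) : C :=
  - phi x + cR m.+1%:R * cint01 phi * pw m x.

Lemma H1rep_Jn m phi : L2 phi -> H1rep (Jn m.+1 phi) (dJn m phi) 0.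
Proof.
move=> Lp.
have H := H1rep_comb (- 1) (- cint01 phi) (H1rep_primc Lp) (H1rep_pw R m).
have H2 := H1rep_comb 1 1 H (H1rep_cst (cint01 phi)).
have {H2} : H1rep (Jn m.+1 phi) (dJn m phi)
    (1 * (-1 * 0 + - cint01 phi * 1) + 1 * cint01 phi).
  have -> : dJn m phi = fun x : R =>
      1 * (-1 * phi x + - cint01 phi * (- cR m.+1%:R * pw m x)) + 1 * 0.
    by apply/funext => x; rewrite /dJn; ring.
  apply: eq_H1rep H2 => x /mem_set Ix.
  rewrite /Jn primc_tail// cint01_primc /pw; ring.
by congr H1rep; ring.
Qed.

Lemma Jn_0 m phi : L2 phi -> Jn m.+1 phi 0 = 0.
Proof. by move=> Lp; rewrite (H1rep0 (H1rep_Jn m Lp)). Qed.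

Lemma Jn_1 m phi : L2 phi -> Jn m.+1 phi 1 = 0.
Proof.
move=> Lp; rewrite /Jn primc_tail//; last exact: I01_1.
by rewrite subrr subrr expr0n/= mulr0 subrr.
Qed.

Lemma H1T_Jn m phi : L2 phi -> H1T (Jn m.+1 phi).
Proof.
move=> Lp; split; last by rewrite Jn_0// Jn_1.
by exists (dJn m phi), 0; exact: H1rep_Jn.
Qed.

Lemma H1T_cst a : H1T (fun _ : R => a).
Proof. by split=> //; exists (fun=> 0), a; exact: H1rep_cst. Qed.

Lemma L2norm2_0 : L2norm2 (fun=> 0 : C) = 0 :> R.
Proof.
have := L2norm2Z 0 (L2_cst (0 : C)); rewrite /cabs2/= expr0n/= addr0 mul0r => ->.
by rewrite mul0r.
Qed.

Lemma Hm1T_0 F : Hm1T F -> F (fun=> 0) = 0.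
Proof.
move=> [lF _]; have := lF 0 0 _ _ (H1T_cst 0) (H1T_cst 0).
have -> : conjc (0 : C) = 0 by rewrite /= oppr0.
by rewrite !mul0r addr0.
Qed.

Lemma H1T_comb a b u w : H1T u -> H1T w -> H1T (fun x => a * u x + b * w x).
Proof.
move=> [[v [c Hu]] u01] [[z [d Hw]] w01]; split; last by rewrite u01 w01.
by do 2 eexists; exact: H1rep_comb Hu Hw.
Qed.

(** The difference [u - w] is represented on [0, 1] by the zero derivative and the constant 0, so
    the H^1 bound forces [F] to vanish on it whatever its values elsewhere. *)
Lemma eq_Hm1T F u w : Hm1T F -> H1T u -> H1T w ->
  (forall x, I x -> u x = w x) -> F u = F w.
Proof.
move=> [lF [M bF]] Hu Hw uw.
have Hd := H1T_comb 1 (-1) Hu Hw.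
have Rd : H1rep (fun x => 1 * u x + (-1) * w x) (fun=> 0) 0.
  apply: eq_H1rep (H1rep_cst 0) => x Ix; rewrite uw//; ring.
have F0 : F (fun x => 1 * u x + (-1) * w x) = 0.
  apply: cabs2_eq0; apply: le_trans (bF _ _ _ Rd Hd.2) _.
  rewrite (@eq_L2norm2 _ _ (fun=> 0)).
    by rewrite L2norm2_0 addr0 mulr0.
  by move=> x Ix; rewrite uw//; ring.
move: F0; rewrite lF//.
have -> : conjc (1 : C) = 1 by rewrite /= oppr0.
have -> : conjc (-1 : C) = -1 by rewrite /= oppr0.
by rewrite mul1r mulN1r => /eqP; rewrite subr_eq0 => /eqP.
Qed.

Lemma L2norm2_H10 u v : H1rep u v 0 -> L2norm2 u <= L2norm2 v.
Proof.
move=> H; have Lv := H1rep_derivative_L2 H.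
rewrite (@eq_L2norm2 _ u (primc v)); first exact: L2norm2_primc_le.
by move=> x /mem_set Ix; rewrite (H1repE H Ix) add0r.
Qed.

Lemma L2norm2_dJn m : exists2 K : R, 0 <= K &
  forall phi, L2 phi -> L2norm2 (dJn m phi) <= K * L2norm2 phi.
Proof.
have L1 := @L2_cst R 1; have Lp := L2_pw R m.
pose s := cabs2 (cR m.+1%:R : C).
(* The 2 comes from splitting the squared norm of a sum; 8 is that 2 times the 4 of [aform_bound],
   which bounds the integral of [phi]. *)
exists (2 + 8 * s * L2norm2 (fun=> 1 : C) * L2norm2 (@pw R m)).
  have s0 : 0 <= s by exact: cabs2_ge0.
  have := mulr_ge0 (mulr_ge0 s0 (@L2norm2_ge0 R (fun=> 1))) (@L2norm2_ge0 R (@pw R m)).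
  lra.
move=> phi Lphi; apply: le_trans (L2norm2D _ _) _; try exact: L2N.
  by apply: L2Z; exact: L2_pw.
rewrite L2norm2Z//.
have -> : L2norm2 (fun x => - phi x) = L2norm2 phi.
  have := L2norm2Z (-1) Lphi; rewrite cabs2N.
  have -> : cabs2 (1 : C) = 1 by rewrite /cabs2/= expr1n expr0n addr0.
  rewrite mul1r => <-; apply: eq_L2norm2 => x _; by rewrite mulN1r.
rewrite cabs2M -/s cint01_primc -aform_cst1//.
have := aform_bound Lphi L1.
have s0 : 0 <= s by exact: cabs2_ge0.
have P0 := mulr_ge0 s0 (@L2norm2_ge0 R (@pw R m)).
move/(ler_wpM2l P0).
move: (L2norm2 phi) (L2norm2 _) (L2norm2 _) (cabs2 _) => A B D E H.
rewrite mulrDl; move: H; rewrite !mulrA => H; lra.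
Qed.

Lemma bdd_antilinear_Jn m F : Hm1T F -> bdd_antilinear (fun phi => F (Jn m.+1 phi)).
Proof.
move=> HF; have [lF [M bF]] := HF; split=> [a b f g Lf Lg|].
  have Hf := H1T_Jn m Lf; have Hg := H1T_Jn m Lg.
  rewrite -lF//; apply: eq_Hm1T => //.
  - by apply: H1T_Jn; apply: L2D; exact: L2Z.
  - exact: H1T_comb.
  move=> x /mem_set Ix; have I1 := I01_1 R.
  have Lab : L2 (fun x => a * f x + b * g x) by apply: L2D; exact: L2Z.
  rewrite /Jn !primc_tail// !cint01_primc !primc_comb//; ring.
have [K K0 HK] := L2norm2_dJn m.
(* Since J_n phi vanishes at 0, its norm is at most that of its derivative, whence the 2. The
   absolute value is there because the sign of [M] is unknown. *)
exists (`|M| * (2 * K)) => phi Lphi.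
have HJ := H1rep_Jn m Lphi; have [_ J01] := H1T_Jn m Lphi.
apply: le_trans (bF _ _ _ HJ J01) _.
have := L2norm2_H10 HJ; have := HK _ Lphi.
have := @L2norm2_ge0 R (Jn m.+1 phi); have := @L2norm2_ge0 R (dJn m phi).
have := normr_ge0 M; have := ler_norm M.
move: (L2norm2 _) (L2norm2 _) (L2norm2 _) => A B D; move: (`|M|) => N MN N0 D0 B0 H1 H2.
apply: (@le_trans _ _ (N * (B + D))); first by rewrite ler_wpM2r// addr_ge0.
rewrite -!mulrA ler_wpM2l//; lra.
Qed.

Lemma Hm1T_emb h : L2 h -> Hm1T (emb h).
Proof.
move=> Lh; have [la _] := bdd_antilinear_aform Lh; split.
  by move=> a b u w [[v [c /H1rep_L2 Lu]] _] [[z [d /H1rep_L2 Lw]] _]; exact: la.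
exists (4 * L2norm2 h) => u v c H _; have Lu := H1rep_L2 H.
apply: le_trans (aform_bound Lh Lu) _.
have := @L2norm2_ge0 R h; have := @L2norm2_ge0 R v => v0 h0.
by rewrite ler_wpM2l ?mulr_ge0// lerDl.
Qed.

(** Both sides are bounded and antilinear in [phi] and agree on D(T). The extension allows test
    functions that need not be smooth or periodic: (1-x)^m, derivatives of H^1_0 functions, and [p]
    itself. *)
Lemma IsPn_L2 m F p : Hm1T F -> IsPn m.+1 F p ->
  forall phi, L2 phi -> F (Jn m.+1 phi) = aform p phi.
Proof.
move=> HF [Lp Fp] phi Lphi; apply/eqP; rewrite -subr_eq0; apply/eqP.
have := bdd_antilinearB (bdd_antilinear_Jn m HF) (bdd_antilinear_aform Lp).
move=> /bdd_antilinear_DT0; apply=> // psi _ Dpsi.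
by rewrite Fp// subrr.
Qed.

(* [(1 - x)^m] spans the kernel of [J_{m+1}]. *)
Lemma IsPn_orthogonal m F p : Hm1T F -> IsPn m.+1 F p -> aform p (@pw R m) = 0.
Proof.
move=> HF Hp; have Lw := L2_pw R m.
rewrite -(IsPn_L2 HF Hp Lw) -(Hm1T_0 HF).
apply: eq_Hm1T => //; [exact: H1T_Jn|exact: H1T_cst|].
have d0 : dJn m (@pw R m) = fun=> 0.
  apply/funext => x; rewrite /dJn cint01_primc cR_nat_pw1; ring.
have := H1rep_Jn m Lw; rewrite d0 => HJ x /mem_set Ix.
by rewrite (H1repE HJ Ix) -(H1repE (H1rep_cst 0) Ix).
Qed.

Lemma conjcN a : conjc (- a) = - conjc a.
Proof. by case: a. Qed.

Lemma conjc0 : conjc (0 : C) = 0.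
Proof. by rewrite /= oppr0. Qed.

(** This turns the moment mu_n(h) into n times a pairing of the primitive h_1 with (1-x)^(n-1).
    Subtracting mu_n(h) from h_1 thus makes P_n h orthogonal to (1-x)^(n-1). *)
Lemma aform_primc_pw m h : L2 h ->
  aform h (@pw R m.+1) = cR m.+1%:R * aform (primc h) (@pw R m).
Proof.
move=> Lh; have := integration_by_parts_H1 (H1rep_primc Lh) (H1rep_pw R m).
rewrite aformZr; [|exact: L2_pw|exact: L2_primc].
rewrite pw1 primc0 mul0r subr0 conjc0 conjcN conjc_cR.
by rewrite mulr0 mulNr => /eqP; rewrite subr_eq0 => /eqP.
Qed.

Lemma IsPn_emb m h : L2 h -> aform h (fun=> 1) = 0 ->
  IsPn m.+1 (emb h) (fun x => primc h x - muk m.+1 h).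
Proof.
move=> Lh h0; have Lp := L2_primc Lh; have Lw := L2_pw R m.
have [k kE] : exists k, k = muk m.+1 h by exists (muk m.+1 h).
rewrite -kE; have Lk := @L2_cst R k.
split; first exact: L2B Lp Lk.
move=> phi /DT_L2 Lphi.
rewrite -[RHS]/(aform (fun x => primc h x - k) phi).
rewrite -[LHS]/(aform h (Jn m.+1 phi)).
(* The boundary terms vanish: h_1 is zero at 0 and J_n phi is zero at 1. *)
have := integration_by_parts_H1 (H1rep_primc Lh) (H1rep_Jn m Lphi).
rewrite Jn_1// primc0 mul0r subr0 conjc0 mulr0 => /eqP; rewrite addr_eq0 => /eqP ->.
rewrite (aformDr (L2N Lphi) (L2Z _ Lw) Lp) (aformNr Lphi Lp) (aformZr _ Lw Lp).
rewrite (aformBl Lp Lk Lphi).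
have -> : aform (fun=> k) phi = k * conjc (cint01 phi).
  have L1 := @L2_cst R 1.
  rewrite cint01_primc -(aform_cst1 Lphi) -(aformC Lphi L1) -(aformZl k L1 Lphi).
  by apply: eq_aform => // x _; rewrite mulr1.
rewrite kE mukE (aform_primc_pw m Lh) conjcM conjc_cR; ring.
Qed.

End Distributions.

(** * The operator A_Y *)

Section Operator.
Variable R : realType.
Local Notation C := R[i].
Local Notation mu := (@lebesgue_measure R).
Local Notation I := (@I01 R).
Implicit Types f h u v w p phi psi : R -> C.
Implicit Types a b c d : C.
Implicit Types g : (R -> C) -> C.

Let one : R -> C := fun=> 1.

Lemma L2_one : L2 one. Proof. exact: L2_cst. Qed.

Lemma aform0l p : L2 p -> aform (fun=> 0) p = 0.
Proof.
move=> Lp; transitivity (aform (fun x => 0 * p x) p).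
  by apply: eq_aform => // x _; rewrite mul0r.
by rewrite aformZl// mul0r.
Qed.

Lemma exists_projection w p : L2 w -> L2 p ->
  exists a, aform (fun x => w x - a * p x) p = 0.
Proof.
move=> Lw Lp; exists (aform w p / aform p p).
rewrite aformBl ?aformZl//; last exact: L2Z.
(* If [p] has norm zero the subtracted term is multiplied by zero, and [aform w p] vanishes by
   Cauchy-Schwarz. *)
have [p0|p0] := eqVneq (aform p p) 0; last by rewrite divfK// subrr.
rewrite p0 mulr0 subr0; apply: cabs2_eq0; apply: le_trans (aform_bound Lw Lp) _.
by move: p0; rewrite L2norm2_aform// => -[->]; rewrite mulr0.
Qed.

Lemma VY_P n Y h : VY n Y h <->
  [/\ L2 h, aform h one = 0 & (Y = Y00 -> aform h (@pw R n) = 0)].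
Proof.
rewrite /VY mukE -[mu0 _]/(aform h one); case: Y => /=.
  by split=> [[Lh [h1 h2]]|[Lh h1 /(_ erefl) h2]]; split.
by split=> [[Lh h1]|[Lh h1 _]]; split.
Qed.

Lemma aform_one_primc h : L2 h -> aform h one = 0 -> primc h 1 = 0.
Proof. by move=> Lh; rewrite aform_cst1. Qed.

(** The definition supplies P_n g and P_n h afresh for every [h]. Taking [h = 0] yields one [p] for
    all [h], and P_n h is replaced by its explicit form. *)
Lemma IsAY_P m Y f g : IsAY m.+1 Y f g ->
  exists2 p, IsPn m.+1 g p &
  forall h, VY m.+1 Y h ->
    aform f h = aform p (fun x => primc h x - muk m.+1 h).
Proof.
move=> [Vf [[Hg g0] fg]].
have V0 : VY m.+1 Y ((fun=> 0) : R -> C).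
  apply/VY_P; split=> [||_]; first exact: L2_cst.
    exact: aform0l L2_one.
  exact: aform0l (L2_pw R _).
have [p [_ [Pp _]]] := fg _ V0; exists p => // h Vh.
have [p' [q [Pp' [Pq ->]]]] := fg _ Vh.
have [Lh h1 _] := (VY_P _ _ _).1 Vh.
have [Lp _] := Pp; have [Lp' _] := Pp'; have [Lq _] := Pq.
have Pe := IsPn_emb m Lh h1; have [Le _] := Pe.
rewrite g0 mul0r addr0 -[LHS]/(aform p' q).
(* Two candidates for P_n of the same functional have equal pairings with any L^2 function: this is
   applied to [g] against [q], then, after conjugation, to [emb h] against [p]. *)
rewrite -(IsPn_L2 Hg Pp' Lq) (IsPn_L2 Hg Pp Lq) aformC//.
by rewrite -(IsPn_L2 (Hm1T_emb Lh) Pq Lp) (IsPn_L2 (Hm1T_emb Lh) Pe Lp) -aformC.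
Qed.

(* Testing against [h] in [V] shows that [f + p_1 + beta (1-x)^n], with
   [p_1] the primitive of [p], is orthogonal to [V]. *)
Lemma variational_representation m Y f p : VY m.+1 Y f -> L2 p ->
  (forall h, VY m.+1 Y h ->
    aform f h = aform p (fun x => primc h x - muk m.+1 h)) ->
  exists a b, [/\ {ae mu, forall x, I x -> f x = a + b * pw m.+1 x - primc p x}
    & Y = Y0C -> b = - primc p 1].
Proof.
move=> /VY_P[Lf f1 fY] Lp fp.
have L1 := L2_one; have Lw := L2_pw R m.+1; have Lpp := L2_primc Lp.
pose be := primc p 1.
pose w x : C := f x + primc p x + be * pw m.+1 x.
have Lfp := L2D Lf Lpp; have Lbw := L2Z be Lw.
have Lww : L2 w by exact: L2D.
have w_orth h : VY m.+1 Y h -> aform w h = 0.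
  move=> Vh; have [Lh h1 _] := (VY_P _ _ _).1 Vh; have Lph := L2_primc Lh.
  rewrite /w aformDl// aformDl// aformZl// fp//.
  rewrite (aformBr Lph (L2_cst _) Lp).
  have := aform_primc_parts Lp Lh.
  rewrite (aform_one_primc Lh h1) conjc0 mulr0 => /eqP; rewrite addr_eq0 => /eqP ->.
  have -> : aform p (fun=> muk m.+1 h) = conjc (muk m.+1 h) * be.
    rewrite /be -aform_cst1// -aformZr//.
    by apply: eq_aform => // x _; rewrite mulr1.
  by rewrite mukE -aformC//; ring.
(* Gram-Schmidt: removing from [w] its components along 1 and, for [Y00], along (1-x)^n leaves a
   remainder in V. As [w] is orthogonal to V, the remainder has norm zero. *)
have [k wk] := exists_projection Lww L1.
pose w1 x : C := w x - k * one x.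
have Lw1 : L2 w1 by apply: L2B => //; exact: L2Z.
case: Y fY fp w_orth => fY fp w_orth.
  have [r er] := exists_projection Lw L1.
  pose e x : C := pw m.+1 x - r * one x.
  have Le : L2 e by apply: L2B => //; exact: L2Z.
  have [l hl] := exists_projection Lw1 Le.
  pose h x : C := w1 x - l * e x.
  have Lh : L2 h by apply: L2B => //; exact: L2Z.
  have h1 : aform h one = 0.
    rewrite /h aformBl ?aformZl//; last exact: L2Z.
    by rewrite [aform w1 _]wk [aform e _]er mulr0 subrr.
  have he : aform h (@pw R m.+1) = 0.
    rewrite (@eq_aform _ h _ h (fun x => e x + r * one x))//; last first.
      by move=> x _; rewrite /e subrK.
    by rewrite aformDr ?aformZr ?h1 ?[aform h e]hl ?mulr0 ?addr0//; exact: L2Z.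
  have Vh : VY m.+1 Y00 h by apply/VY_P.
  have hh : aform h h = 0.
    rewrite [X in aform X _ = _](_ : h = fun x => w x - k * one x - l * e x)//.
    rewrite !aformBl ?aformZl//; try exact: L2Z.
    by rewrite w_orth// (aformC Lh L1) h1 (aformC Lh Le) [aform h e]hl conjc0 !mulr0 !subr0.
  (* Almost everywhere w = k + l e with e = (1-x)^n - r; subtracting the term [be] contained in [w]
     gives these coefficients of 1 and (1-x)^n. *)
  exists (k - l * r), (l - be); split=> //.
  have h0 : L2norm2 h = 0 by move: hh; rewrite L2norm2_aform// => -[].
  apply: ae_imp (L2norm2_eq0_ae Lh h0) => x + Ix => /(_ Ix).
  rewrite /h /w1 /w /e /one => E.
  by apply/eqP; rewrite -subr_eq0 -E; apply/eqP; ring.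
have Vh : VY m.+1 Y0C w1 by apply/VY_P; split.
have hh : aform w1 w1 = 0.
  rewrite [X in aform X _ = _](_ : w1 = fun x => w x - k * one x)//.
  rewrite aformBl ?aformZl//; last exact: L2Z.
  by rewrite w_orth// (aformC Lw1 L1) [aform w1 one]wk conjc0 mulr0 subrr.
have h0 : L2norm2 w1 = 0 by move: hh; rewrite L2norm2_aform// => -[].
exists k, (- be); split=> //.
apply: ae_imp (L2norm2_eq0_ae Lw1 h0) => x + Ix => /(_ Ix).
rewrite /w1 /w /one => E.
by apply/eqP; rewrite -subr_eq0 -E; apply/eqP; ring.
Qed.

Definition represented m a b p (x : R) : C := a + b * pw m.+1 x - primc p x.
Definition represented_deriv m b p (x : R) : C := - (b * cR m.+1%:R) * pw m x - p x.

Lemma H1rep_represented m a b p : L2 p -> H1rep (represented m a b p) (represented_deriv m b p) (a + b).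
Proof.
move=> Lp.
have H := H1rep_comb 1 (-1) (H1rep_comb 1 b (H1rep_cst a) (H1rep_pw R m)) (H1rep_primc Lp).
have {}H : H1rep (represented m a b p) (represented_deriv m b p) (1 * (1 * a + b * 1) + -1 * 0).
  have -> : represented_deriv m b p = fun x : R =>
      1 * (1 * 0 + b * (- cR m.+1%:R * pw m x)) + -1 * p x.
    by apply/funext => x; rewrite /represented_deriv; ring.
  by apply: eq_H1rep H => x Ix; rewrite /represented; ring.
by move: H; congr H1rep; ring.
Qed.

Lemma ae_eq01P f u : ae_eq01 f u <-> {ae mu, forall x, I x -> f x = u x}.
Proof. split; apply: ae_imp => x H Ix; apply: H; first exact: mem_set.
exact: set_mem. Qed.

Lemma DomAY_H1 m Y f : DomAY m.+1 Y f ->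
  L2 f /\ exists u v c, [/\ H1rep u v c, ae_eq01 f u & DomCond m.+1 Y u].
Proof.
move=> [g gA]; have [Vf _] := gA; have [p Pp fp] := IsAY_P gA.
have [Lp _] := Pp.
have [a [b [fab bY]]] := variational_representation Vf Lp fp.
have [Lf f1 fY] := (VY_P _ _ _).1 Vf; split=> //.
have Hu := H1rep_represented m a b Lp; have Lu := H1rep_L2 Hu.
exists (represented m a b p), (represented_deriv m b p), (a + b); split=> //; first exact/ae_eq01P.
have u1 : mu0 (emb (represented m a b p)) = 0.
  by rewrite -[LHS]/(aform _ one) -(aform_ae Lf Lu L2_one fab).
case: Y fY bY {Vf gA fp} => fY bY; split=> //.
  by rewrite mukE -(aform_ae Lf Lu (L2_pw R _) fab) fY.
by rewrite /represented pw0 pw1 primc0 bY//; ring.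
Qed.

(** By continuity the two functions agree everywhere on [0, 1], so [v - v'] has zero primitive. It
    is then orthogonal to the indicators of all [0, x], hence to L^2. *)
Lemma H1rep_deriv_unique u u' v v' c c' : H1rep u v c -> H1rep u' v' c' ->
  {ae mu, forall x, I x -> u x = u' x} ->
  forall f, L2 f -> aform v f = aform v' f.
Proof.
move=> H H' uu f Lf; have Lv := H1rep_derivative_L2 H; have Lv' := H1rep_derivative_L2 H'.
have Lz := L2B Lv Lv'; apply/eqP; rewrite -subr_eq0 -aformBl//; apply/eqP.
move: f Lf; apply: bdd_antilinear_itv0; first exact: bdd_antilinear_aform.
pose z x : C := v x - v' x; pose d := c - c'.
have dz x : x \in I -> u x - u' x = d + primc z x.
  move=> Ix; rewrite (H1repE H Ix) (H1repE H' Ix) /d.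
  have := primc_comb 1 (-1) Ix Lv Lv'.
  rewrite (_ : (fun _ => _) = z); last first.
    by apply/funext => y; rewrite /z mul1r mulN1r.
  by move=> ->; ring.
have zero : {ae mu, forall x, I x -> d + primc z x = 0}.
  by apply: ae_imp uu => x E Ix; rewrite -dz ?E ?subrr//; exact: mem_set.
have zero_all x : I x -> d + primc z x = 0.
  move=> Ix; move: Lz; rewrite -/z => /L2E[La Lb].
  have E y : d + primc z y = Complex
     (complex.Re d + primr (fun x => complex.Re (z x)) y)
     (complex.Im d + primr (fun x => complex.Im (z x)) y).
    by rewrite [in LHS](mkcE z) primc_mkc /mkc; case: (d).
  rewrite E; congr Complex.
    apply: primr_ae_cst0 => //; apply: ae_imp zero => y H1 Iy.
    by have := H1 Iy; rewrite E => -[].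
  apply: primr_ae_cst0 => //; apply: ae_imp zero => y H1 Iy.
  by have := H1 Iy; rewrite E => -[].
have d0 : d = 0.
  by have := zero_all 0 (set_mem (I01_0 R)); rewrite primc0 addr0.
move=> x x0 x1; rewrite -primc_aform//.
have Ix : x \in I by rewrite I01_P x0.
by have := zero_all x (set_mem Ix); rewrite d0 add0r.
Qed.

(** A functional on functions has to find the derivative from the function alone, hence a choice.
    Pairings do not depend on it, and the default 0 occurs only outside H^1, where [Hm1T] asks for
    nothing. *)
Definition weak_derivative u : R -> C :=
  xget (fun=> 0) [set v | exists c, H1rep u v c].

Lemma weak_derivativeP u v c f : H1rep u v c -> L2 f ->
  aform (weak_derivative u) f = aform v f.
Proof.
move=> H Lf; rewrite /weak_derivative.
case: xgetP => [v' _ [c' H']|/(_ v)]; last by case; exists c.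
exact: (H1rep_deriv_unique H' H (aeW _ (fun _ _ => erefl))).
Qed.

(* The preimage of [p] under [P_{m+1}] in [H_Y]. *)
Definition minus_deriv p : (R -> C) -> C :=
  fun phi => - aform p (weak_derivative phi).

Lemma minus_derivE p u v c : L2 p -> H1rep u v c -> minus_deriv p u = - aform p v.
Proof.
move=> Lp H; rewrite /minus_deriv; congr (- _).
have Lv := H1rep_derivative_L2 H.
have Lw : L2 (weak_derivative u).
  rewrite /weak_derivative; case: xgetP => [v' _ [c' /H1rep_derivative_L2]//|_].
  exact: L2_cst.
by rewrite (aformC Lw Lp) (aformC Lv Lp) (weak_derivativeP H Lp).
Qed.

Lemma Hm1T_minus_deriv p : L2 p -> Hm1T (minus_deriv p).
Proof.
move=> Lp; split=> [a b u w [[v [c Hu]] _] [[z [d Hw]] _]|].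
  have Lv := H1rep_derivative_L2 Hu; have Lz := H1rep_derivative_L2 Hw.
  rewrite (minus_derivE Lp (H1rep_comb a b Hu Hw)).
  rewrite (minus_derivE Lp Hu) (minus_derivE Lp Hw).
  rewrite (aformDr (L2Z a Lv) (L2Z b Lz) Lp) !aformZr//; ring.
exists (4 * L2norm2 p) => u v c Hu _; have Lv := H1rep_derivative_L2 Hu.
rewrite (minus_derivE Lp Hu) cabs2N; apply: le_trans (aform_bound Lp Lv) _.
by rewrite ler_wpM2l ?mulr_ge0 ?L2norm2_ge0// lerDr L2norm2_ge0.
Qed.

(** The derivative of J_n phi is - phi plus a multiple of (1-x)^m, and orthogonality removes the
    multiple. *)
Lemma IsPn_minus_deriv m p : L2 p -> aform p (@pw R m) = 0 ->
  IsPn m.+1 (minus_deriv p) p.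
Proof.
move=> Lp p0; split=> // phi /DT_L2 Lphi.
rewrite (minus_derivE Lp (H1rep_Jn m Lphi)).
have Lw := L2_pw R m.
rewrite (aformDr (L2N Lphi) (L2Z _ Lw) Lp) aformNr// aformZr// p0 mulr0 addr0.
by rewrite opprK.
Qed.

Lemma DomAY_of_H1 m Y f u v c : L2 f -> H1rep u v c -> ae_eq01 f u ->
  DomCond m.+1 Y u -> DomAY m.+1 Y f.
Proof.
move=> Lf Hu /ae_eq01P fu uY; have Lu := H1rep_L2 Hu; have Lv := H1rep_derivative_L2 Hu.
have Lw := L2_pw R m; have L1 := L2_one.
(* P_n g has to be orthogonal to (1-x)^m; this condition fixes [l]. *)
have [l vl] := exists_projection Lv Lw.
pose p x : C := l * pw m x - v x.
have Llw := L2Z l Lw.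
have Lp : L2 p by exact: L2B.
have p0 : aform p (@pw R m) = 0.
  have := vl; rewrite !aformBl// => E; rewrite -[RHS]oppr0 -E; ring.
have Hg := Hm1T_minus_deriv Lp.
have g0 : mu0 (minus_deriv p) = 0.
  rewrite /mu0 (minus_derivE Lp (H1rep_cst 1)) -[RHS]oppr0; congr (- _).
  by rewrite aformC ?aform0l ?conjc0//; exact: L2_cst.
exists (minus_deriv p); split.
  have uV : aform u one = 0 /\ (Y = Y00 -> aform u (@pw R m.+1) = 0).
    by case: Y uY => -[]; rewrite ?mukE.
  apply/VY_P; split=> //; first by rewrite (aform_ae Lf Lu L1 fu); case: uV.
  by rewrite (aform_ae Lf Lu (L2_pw R _) fu); case: uV.
split=> // h Vh; have [Lh h1 hY] := (VY_P _ _ _).1 Vh; have Lph := L2_primc Lh.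
exists p, (fun x => primc h x - muk m.+1 h); split; first exact: IsPn_minus_deriv.
split; first exact: IsPn_emb.
rewrite g0 mul0r addr0 -[RHS]/(aform p (fun x => primc h x - muk m.+1 h)).
rewrite (aform_ae Lf Lu Lh fu) (aformBr Lph (L2_cst _) Lp).
have ph1 := aform_one_primc Lh h1.
have -> : aform p (fun=> muk m.+1 h) = conjc (muk m.+1 h) * aform p one.
  by rewrite -aformZr//; apply: eq_aform => // x _; rewrite /one mulr1.
have E1 := integration_by_parts_H1 Hu (H1rep_primc Lh).
rewrite ph1 primc0 conjc0 !mulr0 subrr in E1.
have E2 : conjc (muk m.+1 h) = cR m.+1%:R * aform (@pw R m) (primc h).
  by rewrite mukE aform_primc_pw// conjcM conjc_cR -aformC.
have E3 : cR m.+1%:R * aform (@pw R m) one = 1.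
  by rewrite aform_cst1// cR_nat_pw1.
have E4 : aform v one = u 1 - u 0.
  by rewrite aform_cst1// (H1repE Hu (I01_1 R)) (H1rep0 Hu) addrAC subrr add0r.
(* The discrepancy between the two sides of the form identity. The first factor vanishes for [Y00]
   because [h] is in V, the second for [Y0C] by periodicity of [u]. *)
have E5 : conjc (muk m.+1 h) * (u 1 - u 0) = 0.
  case: Y uY hY {Vh} => [_ hY|[_ ->] _]; last by rewrite subrr mulr0.
  by rewrite mukE hY// conjc0 mul0r.
rewrite !aformBl// !aformZl// E4.
move/eqP: E1; rewrite addr_eq0 => /eqP ->.
have -> : aform (@pw R m) (primc h) = conjc (muk m.+1 h) * aform (@pw R m) one.
  rewrite E2 -[LHS]mul1r -E3; ring.
transitivity (aform u h + conjc (muk m.+1 h) * (u 1 - u 0)).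
  by rewrite E5 addr0.
ring.
Qed.

(** J_n is onto H^1_0: the derivative [psi] has mean zero, so the correction term of J_n drops out
    and [phi] is J_n(- psi) on [0, 1]. *)
Lemma Hm1T_H10 m g p phi psi c : Hm1T g -> IsPn m.+1 g p ->
  H1rep phi psi c -> phi 0 = 0 -> phi 1 = 0 -> g phi = - aform p psi.
Proof.
move=> Hg Pp Hphi p0 p1; have Lpsi := H1rep_derivative_L2 Hphi; have [Lp _] := Pp.
have c0 : c = 0 by rewrite -(H1rep0 Hphi).
have psi1 : primc psi 1 = 0.
  by have := H1repE Hphi (I01_1 R); rewrite p1 c0 add0r => <-.
have Ln := L2N Lpsi.
have nE x : x \in I -> primc (fun y => - psi y) x = - primc psi x.
  move=> Ix; have := primc_comb (-1) 0 Ix Lpsi Lpsi.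
  rewrite mul0r addr0 mulN1r => <-; congr (primc _ x).
  by apply/funext => y; rewrite mulN1r mul0r addr0.
rewrite -aformNr// -(IsPn_L2 Hg Pp Ln); apply: eq_Hm1T => //.
- by split; [exists psi, c|rewrite p0 p1].
- exact: H1T_Jn.
move=> x /mem_set Ix; rewrite (H1repE Hphi Ix) c0 /Jn primc_tail// cint01_primc.
by rewrite !nE ?I01_1// psi1; ring.
Qed.

Lemma IsAY_IsIdmInv m Y f g u v c : IsAY m.+1 Y f g -> H1rep u v c ->
  ae_eq01 f u -> IsIdmInv g (rhs m.+1 u v).
Proof.
move=> gA Hu /ae_eq01P fu; have [Vf [[Hg g0] _]] := gA.
split=> //; split=> // phi psi d Hphi p0 p1.
have [p Pp fp] := IsAY_P gA; have [Lp _] := Pp.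
have [a [b [fab _]]] := variational_representation Vf Lp fp.
have Hr := H1rep_represented m a b Lp.
have ur : {ae mu, forall x, I x -> u x = represented m a b p x}.
  by apply: ae_imp2 fu fab => x + + Ix => /(_ Ix) <- /(_ Ix) ->.
have Lpsi := H1rep_derivative_L2 Hphi; have Lphi := H1rep_L2 Hphi.
have Lu := H1rep_L2 Hu; have Lv := H1rep_derivative_L2 Hu; have Lw := L2_pw R m.
have vE q : L2 q ->
    aform v q = - (b * cR m.+1%:R) * aform (@pw R m) q - aform p q.
  move=> Lq; rewrite (H1rep_deriv_unique Hu Hr ur Lq).
  by rewrite (aformBl (L2Z _ Lw) Lp Lq) aformZl.
rewrite (Hm1T_H10 Hg Pp Hphi p0 p1) /rhs.
rewrite -[X in _ = X + _]/(aform v psi) -[X in _ * X]/(aform (@pw R (m.+1 - 2)) phi).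
have -> : - aform p psi = aform v psi + b * cR m.+1%:R * aform (@pw R m) psi.
  by rewrite vE//; ring.
congr (_ + _); case: m Hr ur Pp Lw vE Vf gA fp fab => [|k] Hr ur Pp Lw vE Vf gA fp fab.
  (* For n = 1 the exponent [n - 2] truncates to 0, harmlessly since gamma is 0. The remaining term
     pairs the constant 1 with [psi], which has mean zero. *)
  rewrite /gamma mul0r.
  suff -> : aform (@pw R 0) psi = 0 by rewrite mulr0.
  rewrite (aformC Lpsi Lw); have -> : @pw R 0 = one.
    by apply/funext => x; rewrite /pw expr0.
  rewrite aform_cst1//; have := H1repE Hphi (I01_1 R).
  by rewrite p1 -(H1rep0 Hphi) p0 add0r => <-; rewrite conjc0.
have Lk := L2_pw R k.
have pw_parts q z e : H1rep q z e -> L2 z -> 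
    aform z (@pw R k.+1) = cR k.+1%:R * aform q (@pw R k) - q 0.
  move=> Hq Lz; have Lq := H1rep_L2 Hq.
  have := integration_by_parts_H1 Hq (H1rep_pw R k).
  rewrite pw1 pw0 conjc0 mulr0 aformZr// conjcN conjc_cR.
  have -> : conjc (1 : C) = 1 by rewrite /= oppr0.
  by move=> /eqP; rewrite mulNr subr_eq => /eqP ->; ring.
have E1 : aform (@pw R k.+1) psi = cR k.+1%:R * aform (@pw R k) phi.
  rewrite (aformC Lpsi Lw) (pw_parts _ _ _ Hphi Lpsi) p0 subr0 conjcM conjc_cR.
  by rewrite -aformC.
have E2 := pw_parts _ _ _ Hu Lv.
(* Pairing u' with (1-x)^(n-1) eliminates [p] and leaves a linear equation for [b] in terms of u(0)
   and mu_(n-2)(u). *)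
have E3 := vE _ Lw; rewrite (IsPn_orthogonal Hg Pp) subr0 E2 in E3.
have E4 := aform_pw_pw R k.+1.
rewrite E1 /gamma /= mukE.
have -> : (k.+2 - 2)%N = k by rewrite subSS subSS subn0.
have -> : (2 * k.+2 - 1)%N = (k.+1 + k.+1).+1.
  by rewrite mul2n -addnn addnS subn1.
rewrite mulrA; congr (_ * _).
rewrite !cRM.
have bE : b * cR k.+2%:R = cR (k.+1 + k.+1).+1%:R * (u 0 - cR k.+1%:R * aform u (@pw R k)).
  transitivity (b * cR k.+2%:R * (cR (k.+1 + k.+1).+1%:R * aform (@pw R k.+1) (@pw R k.+1))).
    by rewrite E4 mulr1.
  have -> : u 0 - cR k.+1%:R * aform u (@pw R k) =
      b * cR k.+2%:R * aform (@pw R k.+1) (@pw R k.+1).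
    by rewrite -opprB E3; ring.
  ring.
rewrite bE; ring.
Qed.

End Operator.

Theorem mainTheorem9 (R : realType) (n : nat) (Y : Ychoice) :
  (1 <= n)%N ->
  (forall f : R -> R[i],
     DomAY n Y f <->
     (L2 f /\ exists u v c, H1rep u v c /\ ae_eq01 f u /\ DomCond n Y u))
  /\
  (forall (f : R -> R[i]) (g : (R -> R[i]) -> R[i]) (u v : R -> R[i]) (c : R[i]),
     IsAY n Y f g -> H1rep u v c -> ae_eq01 f u ->
     IsIdmInv g (rhs n u v)).
Proof.
case: n => [//|m _]; split=> [f|f g u v c]; last exact: IsAY_IsIdmInv.
split=> [/DomAY_H1[Lf [u [v [c [Hu fu uY]]]]]|[Lf [u [v [c [Hu [fu uY]]]]]]].
  by split=> //; exists u, v, c.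
exact: DomAY_of_H1 Lf Hu fu uY.
Qed.
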